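(* Let $\Sigma^{2}$ be an isometrically immersed surface in a homogeneous space $\mathbb{E}^{3}(\kappa,\tau)$. Then $$\mathrm{div}(P(2\nabla H))=\square(2H)-2C(\kappa-4\tau^{2})\,T(H).$$
   Context: Ambient space. For real numbers $\kappa,\tau$ with $\kappa\neq 4\tau^{2}$, $\mathbb{E}^{3}(\kappa,\tau)$ denotes the simply connected homogeneous Riemannian $3$-manifold with $4$-dimensional isometry group which is the total space of a Riemannian submersion $\pi:\mathbb{E}^{3}(\kappa,\tau)\to\mathbb{M}^{2}(\kappa)$ with constant bundle curvature $\tau$, where $\mathbb{M}^{2}(\kappa)$ is the simply connected surface of constant curvature $\kappa$; the fibers are geodesics and are the trajectories of a vertical unit Killing field $\xi$. The space is oriented, with vector product $\wedge$, so that $\overline{\nabla}_{X}\xi=\tau(X\wedge\xi)$, $\overline{\nabla}$ being the Levi-Civita connection. In local coordinates the metric is $\lambda^{2}(dx^{2}+dy^{2})+(dz+\tau\lambda(y\,dx-x\,dy))^{2}$ with $\lambda=(1+\frac{\kappa}{4}(x^{2}+y^{2}))^{-1}$, and $\xi=\partial_{z}$. Surfaces are smooth, connected, orientable, and oriented by a global unit normal $N$. $\mathrm{div}$ and $\nabla$ are the divergence and gradient/Levi-Civita connection of $\Sigma$; the shape operator is $A(X)=-\overline{\nabla}_{X}N$, $H=\frac12\mathrm{tr}(A)$, $C=\langle N,\xi\rangle$, $T=\xi-CN$ is the tangential part of $\xi$, and $T(H)=\langle\nabla H,T\rangle$. $P=2HI-A$ is the first Newton transformation, and the Cheng-Yau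 operator is $\square u=\mathrm{tr}(P\circ\mathrm{Hess}\,u)$ for smooth $u:\Sigma\to\mathbb{R}$. *)

(* Defs.v *)
From HB Require Import structures.
From mathcomp Require Import all_boot all_order all_algebra.
From mathcomp Require Import all_classical all_reals all_analysis.

Set Implicit Arguments.
Unset Strict Implicit.
Unset Printing Implicit Defensive.

Import Order.TTheory GRing.Theory Num.Theory.
Import numFieldNormedType.Exports.

Local Open Scope classical_set_scope.
Local Open Scope ring_scope.

(* Tangent vectors are row vectors of components and linear maps act on the
   right: the matrix of L : V -> W has i-th row L(e_i), and L(v) = v *m L.
   This is also the convention of the Jacobian 'J f x of MathComp-Analysis. *)

Section Calculus.
Context {R : realType}.

Definition evec n (i : 'I_n) : 'rV[R]_n := delta_mx 0 i.

(* C^infinity on the open set U: f and all its iterated partial derivatives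
   are (Frechet) differentiable at every point of U. *)
Definition smooth_on m (V : normedModType R) (U : set 'rV[R]_m)
    (f : 'rV[R]_m -> V) : Prop :=
  forall (s : seq 'I_m) (x : 'rV[R]_m), U x ->
    differentiable (foldr (fun i h => 'D_(evec i) h) f s) x.

Definition inner n (g : 'M[R]_n) (u v : 'rV[R]_n) : R :=
  (u *m g *m v^T) 0 0.

End Calculus.

Section LocalGeometry.
Context {R : realType}.

Definition christoffel n (G : 'rV[R]_n -> 'M[R]_n) (y : 'rV[R]_n)
    (k i j : 'I_n) : R :=
  2^-1 * \sum_(l < n) invmx (G y) k l *
    (('D_(evec i) G y) j l + ('D_(evec j) G y) i l - ('D_(evec l) G y) i j).

(* Covariant derivative in the direction v of a vector field W along the map
   f : R^m -> R^n, for the Levi-Civita connection of the metric G on R^n. *)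
Definition covd m n (G : 'rV[R]_n -> 'M[R]_n) (f : 'rV[R]_m -> 'rV[R]_n)
    (W : 'rV[R]_m -> 'rV[R]_n) (v : 'rV[R]_m) (x : 'rV[R]_m) : 'rV[R]_n :=
  'D_v W x +
  \row_(k < n) \sum_(i < n) \sum_(j < n)
    christoffel G (f x) k i j * ('D_v f x) 0 i * (W x) 0 j.

(* The linear map v |-> covd G f W v x. *)
Definition covmx m n (G : 'rV[R]_n -> 'M[R]_n) (f : 'rV[R]_m -> 'rV[R]_n)
    (W : 'rV[R]_m -> 'rV[R]_n) (x : 'rV[R]_m) : 'M[R]_(m, n) :=
  \matrix_(i < m) covd G f W (evec i) x.

Definition divergence n (g : 'rV[R]_n -> 'M[R]_n) (X : 'rV[R]_n -> 'rV[R]_n)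
    (x : 'rV[R]_n) : R :=
  \tr (covmx g id X x).

Definition grad n (g : 'rV[R]_n -> 'M[R]_n) (u : 'rV[R]_n -> R)
    (x : 'rV[R]_n) : 'rV[R]_n :=
  (\row_(i < n) 'D_(evec i) u x) *m invmx (g x).

(* Hess u as the endomorphism X |-> nabla_X (grad u). *)
Definition hess n (g : 'rV[R]_n -> 'M[R]_n) (u : 'rV[R]_n -> R)
    (x : 'rV[R]_n) : 'M[R]_n :=
  covmx g id (grad g u) x.

(* <R(e1,e2)e2, e1> / det g with
   R(X,Y)Z = nabla_X nabla_Y Z - nabla_Y nabla_X Z - nabla_[X,Y] Z. *)
Definition gauss_curvature (g : 'rV[R]_2 -> 'M[R]_2) (x : 'rV[R]_2) : R :=
  let e1 : 'rV[R]_2 := evec 0 in let e2 : 'rV[R]_2 := evec 1 in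
  let nabla v W := covd g id W v in
  inner (g x) (nabla e1 (nabla e2 (cst e2)) x - nabla e2 (nabla e1 (cst e2)) x)
    e1 / \det (g x).

(* A surface f : R^2 -> R^3 with unit normal field N along f, in an ambient
   space with metric G. Since 'J f y has full rank, v *m pinvmx ('J f y) is
   the tangent vector X of the surface with df(X) = v, for v tangent. *)

Definition shape_operator (G : 'rV[R]_3 -> 'M[R]_3) (f N : 'rV[R]_2 -> 'rV[R]_3)
    (y : 'rV[R]_2) : 'M[R]_2 :=
  (- covmx G f N y) *m pinvmx ('J f y).

Definition mean_curvature (G : 'rV[R]_3 -> 'M[R]_3) (f N : 'rV[R]_2 -> 'rV[R]_3)
    (y : 'rV[R]_2) : R :=
  2^-1 * \tr (shape_operator G f N y).

Definition newton (G : 'rV[R]_3 -> 'M[R]_3) (f N : 'rV[R]_2 -> 'rV[R]_3)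
    (y : 'rV[R]_2) : 'M[R]_2 :=
  (2 * mean_curvature G f N y)%:M - shape_operator G f N y.

Definition cheng_yau (g : 'rV[R]_2 -> 'M[R]_2) (P : 'rV[R]_2 -> 'M[R]_2)
    (u : 'rV[R]_2 -> R) (y : 'rV[R]_2) : R :=
  \tr (hess g u y *m P y).

(* xi is the ambient vector field, in coordinates. *)
Definition angle_function (G : 'rV[R]_3 -> 'M[R]_3) (xi : 'rV[R]_3 -> 'rV[R]_3)
    (f N : 'rV[R]_2 -> 'rV[R]_3) (y : 'rV[R]_2) : R :=
  inner (G (f y)) (N y) (xi (f y)).

Definition tangent_part (G : 'rV[R]_3 -> 'M[R]_3) (xi : 'rV[R]_3 -> 'rV[R]_3)
    (f N : 'rV[R]_2 -> 'rV[R]_3) (y : 'rV[R]_2) : 'rV[R]_2 :=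
  (xi (f y) - angle_function G xi f N y *: N y) *m pinvmx ('J f y).

End LocalGeometry.

Section Manifolds.
Context {R : realType}.

Record chart (n : nat) (M : topologicalType) := Chart {
  cdom : set M;
  ccod : set 'rV[R]_n;
  cmap : M -> 'rV[R]_n;
  cinv : 'rV[R]_n -> M;
  cdom_open : open cdom;
  ccod_open : open ccod;
  cmap_fun : forall p, cdom p -> ccod (cmap p);
  cinv_fun : forall x, ccod x -> cdom (cinv x);
  cmapK : forall p, cdom p -> cinv (cmap p) = p;
  cinvK : forall x, ccod x -> cmap (cinv x) = x;
  cmap_continuous : {within cdom, continuous cmap};
  cinv_continuous : {within ccod, continuous cinv} }.

(* Local representation of f : M -> N in the charts a and b, and its domain. *)
Definition lrep m n (M N : topologicalType) (a : chart m M) (b : chart n N)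
    (f : M -> N) : 'rV[R]_m -> 'rV[R]_n :=
  cmap b \o f \o cinv a.

Definition lrep_dom m n (M N : topologicalType) (a : chart m M) (b : chart n N)
    (f : M -> N) : set 'rV[R]_m :=
  [set x | ccod a x /\ cdom b (f (cinv a x))].

Record manifold (n : nat) := Manifold {
  carrier :> topologicalType;
  atlas : set (chart n carrier);
  manifold_hausdorff : hausdorff_space carrier;
  manifold_countable : @second_countable carrier;
  atlas_cover : forall p : carrier, exists2 a, atlas a & cdom a p;
  atlas_smooth : forall a b, atlas a -> atlas b ->
    smooth_on (lrep_dom a b id) (lrep a b id) }.

(* metric a x is the matrix of the metric in the chart a at the point of
   coordinates x. *)
Record riemannian (n : nat) := Riemannian {
  space :> manifold n;
  metric : chart n space -> 'rV[R]_n -> 'M[R]_n;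
  metric_sym : forall a x, atlas a -> ccod a x -> (metric a x)^T = metric a x;
  metric_pos : forall a x v, atlas a -> ccod a x -> v != 0 ->
    0 < inner (metric a x) v v;
  metric_smooth : forall a, atlas a -> smooth_on (ccod a) (metric a);
  metric_change : forall a b x, atlas a -> atlas b -> lrep_dom a b id x ->
    metric a x = 'J (lrep a b id) x *m metric b (lrep a b id x)
                 *m ('J (lrep a b id) x)^T }.

Definition smooth_map m n (M : manifold m) (N : manifold n) (f : M -> N) : Prop :=
  continuous f /\
  forall (a : chart m M) (b : chart n N), atlas a -> atlas b ->
    smooth_on (lrep_dom a b f) (lrep a b f).

Definition immersion m n (M : manifold m) (N : manifold n) (f : M -> N) : Prop :=
  smooth_map f /\
  forall (a : chart m M) (b : chart n N) x, atlas a -> atlas b ->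
    lrep_dom a b f x -> row_free ('J (lrep a b f) x).

Definition preserves_metric m n (M : riemannian m) (N : riemannian n)
    (f : M -> N) : Prop :=
  forall (a : chart m M) (b : chart n N) x, atlas a -> atlas b ->
    lrep_dom a b f x ->
    metric a x = 'J (lrep a b f) x *m metric b (lrep a b f x)
                 *m ('J (lrep a b f) x)^T.

Definition isometric_immersion m n (M : riemannian m) (N : riemannian n)
    (f : M -> N) : Prop :=
  immersion f /\ preserves_metric f.

Definition isometry n (M : riemannian n) (f : M -> M) : Prop :=
  [/\ smooth_map f, preserves_metric f &
      exists h : M -> M, [/\ smooth_map h, cancel f h & cancel h f]].

Definition homogeneous n (M : riemannian n) : Prop :=
  forall p q : M, exists2 f : M -> M, isometry f & f p = q.

Definition simply_connected (M : topologicalType) : Prop :=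
  [/\ inhabited M,
      forall p q : M, exists c : R -> M,
        [/\ {within `[0, 1], continuous c}, c 0 = p & c 1 = q] &
      forall c : R -> M, {within `[0, 1], continuous c} -> c 0 = c 1 ->
        exists F : R * R -> M,
          [/\ {within `[0, 1] `*` `[0, 1], continuous F},
              forall s, s \in `[0, 1] -> F (s, 0) = c s,
              forall s, s \in `[0, 1] -> F (s, 1) = c 0 &
              forall t, t \in `[0, 1] -> F (0, t) = c 0 /\ F (1, t) = c 0]].

End Manifolds.

Arguments chart R n M : clear implicits.
Arguments manifold R n : clear implicits.
Arguments riemannian R n : clear implicits.
Arguments simply_connected R M : clear implicits.

Section HomogeneousSpaces.
Context {R : realType}.

Definition conformal_denom (kappa : R) (x : 'rV[R]_3) : R :=
  1 + kappa / 4 * (x 0 0 ^+ 2 + x 0 1 ^+ 2).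

(* lambda^2 (dx^2 + dy^2) + (dz + tau lambda (y dx - x dy))^2 *)
Definition model_metric (kappa tau : R) (x : 'rV[R]_3) : 'M[R]_3 :=
  let lambda := (conformal_denom kappa x)^-1 in
  let omega : 'rV[R]_3 := (tau * lambda * x 0 1) *: evec 0
                        - (tau * lambda * x 0 0) *: evec 1 + evec ord_max in
  lambda ^+ 2 *: pid_mx 2 + omega^T *m omega.

(* The vertical field xi = d/dz in canonical coordinates. *)
Definition vertical (x : 'rV[R]_3) : 'rV[R]_3 := evec ord_max.

(* E^3(kappa, tau): its atlas consists of canonical coordinate charts, whose
   transition maps preserve xi and the orientation (dx, dy, dz). For kappa <= 0
   one chart is enough; for kappa > 0 one chart does not cover the space.
   The identity nabla_X xi = tau (X /\ xi), i.e. that tau is the bundle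
   curvature, is contained in the form of the metric. *)
Record homogeneous_space3 (kappa tau : R) := HomogeneousSpace3 {
  total :> riemannian R 3;
  total_simply_connected : simply_connected R total;
  total_homogeneous : homogeneous total;
  canonical_domain : forall (b : chart R 3 total) x, atlas b -> ccod b x ->
    0 < conformal_denom kappa x;
  canonical_metric : forall (b : chart R 3 total) x, atlas b -> ccod b x ->
    metric b x = model_metric kappa tau x;
  vertical_change : forall (b c : chart R 3 total) x, atlas b -> atlas c ->
    lrep_dom b c id x ->
    vertical x *m 'J (lrep b c id) x = vertical (lrep b c id x);
  orientation_change : forall (b c : chart R 3 total) x, atlas b -> atlas c ->
    lrep_dom b c id x -> 0 < \det ('J (lrep b c id) x);
  base : riemannian R 2;
  base_simply_connected : simply_connected R base;
  base_homogeneous : homogeneous base;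
  base_curvature : forall (c : chart R 2 base) y, atlas c -> ccod c y ->
    gauss_curvature (metric c) y = kappa;
  proj : total -> base;
  proj_smooth : smooth_map proj;
  proj_surjective : forall q : base, exists p : total, proj p = q;
  proj_vertical : forall (b : chart R 3 total) (c : chart R 2 base) x,
    atlas b -> atlas c -> lrep_dom b c proj x ->
    vertical x *m 'J (lrep b c proj) x = 0;
  proj_horizontal : forall (b : chart R 3 total) (c : chart R 2 base) x u v,
    atlas b -> atlas c -> lrep_dom b c proj x ->
    inner (metric b x) u (vertical x) = 0 ->
    inner (metric b x) v (vertical x) = 0 ->
    inner (metric c (lrep b c proj x)) (u *m 'J (lrep b c proj) x)
      (v *m 'J (lrep b c proj) x) = inner (metric b x) u v }.

(* Smooth unit normal field along psi; normal b p is its value at p, in the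
   ambient chart b at psi p. *)
Record unit_normal (S : riemannian R 2) (E : riemannian R 3) (psi : S -> E) :=
  UnitNormal {
  normal :> chart R 3 E -> S -> 'rV[R]_3;
  normal_change : forall (b c : chart R 3 E) (p : S), atlas b -> atlas c ->
    cdom b (psi p) -> cdom c (psi p) ->
    normal c p = normal b p *m 'J (lrep b c id) (cmap b (psi p));
  normal_smooth : forall (a : chart R 2 S) (b : chart R 3 E), atlas a -> atlas b ->
    smooth_on (lrep_dom a b psi) (normal b \o cinv a);
  normal_unit : forall (b : chart R 3 E) (p : S), atlas b -> cdom b (psi p) ->
    inner (metric b (cmap b (psi p))) (normal b p) (normal b p) = 1;
  normal_orthogonal : forall (a : chart R 2 S) (b : chart R 3 E) (p : S) v,
    atlas a -> atlas b -> cdom a p -> cdom b (psi p) ->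
    inner (metric b (cmap b (psi p))) (v *m 'J (lrep a b psi) (cmap a p))
      (normal b p) = 0 }.

End HomogeneousSpaces.

(* Main.v *)
(* By the Leibniz rule div (P X) = tr (P o nabla X) + <div P, X>; for X = 2 grad H
   the first term is the Cheng-Yau operator of 2H, so the claim amounts to
   div P = - (kappa - 4 tau^2) C T.  Tracing the Codazzi equation expresses div P
   through R(., .)N, and the curvature of E^3(kappa, tau), computed in canonical
   coordinates, satisfies
     R(X, Y)N = (kappa - 4 tau^2) C (<X, xi> Y - <Y, xi> X)
   for X and Y orthogonal to N. *)
Require Import Defs.
From mathcomp Require Import all_boot all_order all_algebra.
From mathcomp Require Import ring.
From mathcomp Require Import all_classical all_reals all_analysis.
Import Order.TTheory GRing.Theory Num.Theory.
Import numFieldNormedType.Exports.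
Local Open Scope classical_set_scope.
Local Open Scope ring_scope.

Set Implicit Arguments.
Unset Strict Implicit.
Unset Printing Implicit Defensive.

(** * Derivatives of matrix-valued functions *)

(** The coefficient κ - 4τ² is the gap between the curvature κ - 3τ² of horizontal planes and the
    curvature τ² of vertical ones: the curvature tensor is a constant-curvature part with factor κ -
    3τ², which contributes nothing to R(X, Y)N for X and Y orthogonal to N, plus a correction by ξ
    with factor κ - 4τ². The minus sign of div P comes from tracing over a plane, 1 - 2 = -1. The
    Codazzi equation is the tangential part of the commutator of two covariant derivatives along the
    immersion, applied to the normal. A matrix with [p] rows is read as [p] vector fields along the
    map, so that one calculus serves the normal, the Jacobian and the derivative of the normal. Two
    obstacles shape the rest. The shape operator is defined with [pinvmx], whose dependence on the
    point is not visibly smooth, so it is rewritten with the explicit projection [G J^T g^-1]. And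
    each differentiation rule asks for differentiability, which is supplied by a predicate [Ck]
    stable under every operation needed, matrix inversion included. *)

Section MatrixDifferentiation.
Context {R : realType} {V : normedModType R}.

Lemma near_eq_differentiable (W : normedModType R) (f g : V -> W) x :
  (\forall y \near x, f y = g y) -> differentiable f x -> differentiable g x.
Proof.
move=> fg df.
have gfx : g x = f x by rewrite (nbhs_singleton fg).
have fg0 : \forall h \near 0, g (h + x) = f (h + x).
  by have := fg; rewrite (near_shift 0 x); apply: filterS => h /=; rewrite subr0.
have e : g \o shift x = cst (g x) + 'd f x +o_ (0 : V) id.
  apply/eqaddoP => _/posnumP[eps].
  have /eqaddoP/(_ eps%:num ltac:(by [])) := diff_locally df.
  by apply: filter_app; near=> h; rewrite !fctE /= gfx (near fg0 h).
apply/diff_locallyP; have c := diff_continuous df.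
by rewrite (diff_unique c e).
Unshelve. all: by end_near. Qed.

Lemma differentiable_entry p q (M : V -> 'M[R]_(p, q)) x i j :
  differentiable M x -> differentiable (fun y => M y i j) x.
Proof.
move=> dM; exact: (differentiable_comp dM (@differentiable_coord _ _ _ _ i j)).
Qed.

Lemma differentiable_mx p q (M : V -> 'M[R]_(p, q)) x :
  (forall i j, differentiable (fun y => M y i j) x) -> differentiable M x.
Proof.
move=> dM.
have -> : M = \sum_(i < p) \sum_(j < q) (fun y => M y i j *: delta_mx i j).
  apply/funext => y; rewrite {1}[M y]matrix_sum_delta fct_sumE.
  by apply: eq_bigr => i _; rewrite fct_sumE.
apply: differentiable_sum => i; apply: differentiable_sum => j.
exact: differentiableZl.
Qed.

Lemma derive_entry p q (M : V -> 'M[R]_(p, q)) x v i j : differentiable M x ->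
  'D_v (fun y => M y i j) x = ('D_v M x) i j.
Proof. by move=> dM; rewrite derive_mx ?mxE//; exact: diff_derivable. Qed.

Lemma differentiable_mulmx p q r (M : V -> 'M[R]_(p, q)) (N : V -> 'M[R]_(q, r))
    x : differentiable M x -> differentiable N x ->
  differentiable (fun y => M y *m N y) x.
Proof.
move=> dM dN; apply: differentiable_mx => i j.
have -> : (fun y => (M y *m N y) i j) =
    \sum_(k < q) (fun y => M y i k) * (fun y => N y k j).
  by apply/funext => y; rewrite mxE fct_sumE.
by apply: differentiable_sum => k; apply: differentiableM;
  apply: differentiable_entry.
Qed.

Lemma derive_mulmx p q r (M : V -> 'M[R]_(p, q)) (N : V -> 'M[R]_(q, r))
    x v : differentiable M x -> differentiable N x ->
  'D_v (fun y => M y *m N y) x = 'D_v M x *m N x + M x *m 'D_v N x.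
Proof.
move=> dM dN; apply/matrixP => i j.
rewrite -derive_entry; last exact: differentiable_mulmx.
have -> : (fun y => (M y *m N y) i j) =
    \sum_(k < q) (fun y => M y i k) * (fun y => N y k j).
  by apply/funext => y; rewrite mxE fct_sumE.
have dMe k : derivable (fun y => M y i k) x v.
  exact/diff_derivable/differentiable_entry.
have dNe k : derivable (fun y => N y k j) x v.
  exact/diff_derivable/differentiable_entry.
rewrite derive_sum => [|k]; last exact: derivableM.
rewrite !mxE -big_split /=; apply: eq_bigr => k _.
by rewrite deriveM// !derive_entry// /GRing.scale/= addrC mulrC [N x k j * _]mulrC
  [_ * M x i k]mulrC.
Qed.

Lemma differentiable_scalemx p q (c : V -> R) (M : V -> 'M[R]_(p, q)) x :
  differentiable c x -> differentiable M x ->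
  differentiable (fun y => c y *: M y) x.
Proof.
move=> dc dM; apply: differentiable_mx => i j; under eq_fun do rewrite mxE.
by apply: differentiableM => //; exact: differentiable_entry.
Qed.

Lemma derive_scalemx p q (c : V -> R) (M : V -> 'M[R]_(p, q)) x v :
  differentiable c x -> differentiable M x ->
  'D_v (fun y => c y *: M y) x = 'D_v c x *: M x + c x *: 'D_v M x.
Proof.
move=> dc dM; apply/matrixP => i j.
rewrite -derive_entry; last exact: differentiable_scalemx.
under eq_fun do rewrite mxE.
rewrite deriveM; [|exact/diff_derivable|
  by apply/diff_derivable; exact: differentiable_entry].
rewrite derive_entry// [RHS]mxE [X in _ = X + _]mxE [X in _ = _ + X]mxE addrC.
by congr (_ + _); exact: mulrC.
Qed.

Lemma differentiable_trmx p q (M : V -> 'M[R]_(p, q)) x :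
  differentiable M x -> differentiable (fun y => (M y)^T) x.
Proof.
move=> dM; apply: differentiable_mx => i j.
under eq_fun do rewrite mxE.
exact: differentiable_entry.
Qed.

Lemma derive_trmx p q (M : V -> 'M[R]_(p, q)) x v : differentiable M x ->
  'D_v (fun y => (M y)^T) x = ('D_v M x)^T.
Proof.
move=> dM; apply/matrixP => i j.
rewrite -derive_entry; last exact: differentiable_trmx.
by under eq_fun do rewrite mxE; rewrite derive_entry// mxE.
Qed.

Lemma differentiable_mxtrace n (M : V -> 'M[R]_n) x :
  differentiable M x -> differentiable (fun y => \tr (M y)) x.
Proof.
move=> dM; have -> : (fun y => \tr (M y)) = \sum_(i < n) (fun y => M y i i).
  by apply/funext => y; rewrite fct_sumE.
by apply: differentiable_sum => i; exact: differentiable_entry.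
Qed.

Lemma derive_mxtrace n (M : V -> 'M[R]_n) x v : differentiable M x ->
  'D_v (fun y => \tr (M y)) x = \tr ('D_v M x).
Proof.
move=> dM; have -> : (fun y => \tr (M y)) = \sum_(i < n) (fun y => M y i i).
  by apply/funext => y; rewrite fct_sumE.
rewrite derive_sum => [|i]; last exact/diff_derivable/differentiable_entry.
by apply: eq_bigr => i _; rewrite derive_entry.
Qed.

Lemma differentiable_prod (I : Type) (s : seq I) (f : I -> V -> R) x :
  (forall i, differentiable (f i) x) ->
  differentiable (fun y => \prod_(i <- s) f i y) x.
Proof.
move=> df; elim: s => [|i s IH].
  by under eq_fun do rewrite big_nil; exact: differentiable_cst.
under eq_fun do rewrite big_cons.
exact: (differentiableM (df i) IH).
Qed.

Lemma differentiable_bigsum (I : Type) (s : seq I) (W : normedModType R)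
    (f : I -> V -> W) x :
  (forall i, differentiable (f i) x) ->
  differentiable (fun y => \sum_(i <- s) f i y) x.
Proof.
move=> df; elim: s => [|i s IH].
  by under eq_fun do rewrite big_nil; exact: differentiable_cst.
under eq_fun do rewrite big_cons.
exact: (differentiableD (df i) IH).
Qed.

Lemma differentiable_det n (M : V -> 'M[R]_n) x :
  differentiable M x -> differentiable (fun y => \det (M y)) x.
Proof.
move=> dM; apply: differentiable_bigsum => s.
apply: (@differentiableM _ _ (cst _)); first exact: differentiable_cst.
by apply: differentiable_prod => i; exact: differentiable_entry.
Qed.

(** Cramer's rule: near [x] the inverse is the adjugate divided by the determinant, and both are
    polynomial in the entries. *)
Lemma differentiable_invmx n (M : V -> 'M[R]_n) x :
  differentiable M x -> (\forall y \near x, M y \in unitmx) ->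
  differentiable (fun y => invmx (M y)) x.
Proof.
move=> dM uM.
apply: (@near_eq_differentiable _ (fun y => (\det (M y))^-1 *: \adj (M y))).
  by apply: filterS uM => y uy; rewrite /invmx uy.
apply: differentiable_mx => i j; under eq_fun do rewrite mxE.
apply: (@differentiableM _ _ (fun y => (\det (M y))^-1)).
  apply: differentiableV; first exact: differentiable_det.
  by have := nbhs_singleton uM; rewrite unitmxE unitfE.
under eq_fun do rewrite mxE /cofactor.
apply: (@differentiableM _ _ (cst _)); first exact: differentiable_cst.
apply: differentiable_det; apply: differentiable_mx => k l.
under eq_fun do rewrite !mxE.
exact: differentiable_entry.
Qed.

Lemma derive_invmx n (M : V -> 'M[R]_n) x v :
  differentiable M x -> (\forall y \near x, M y \in unitmx) ->
  'D_v (fun y => invmx (M y)) x = - (invmx (M x) *m 'D_v M x *m invmx (M x)).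
Proof.
move=> dM uM.
have dI := differentiable_invmx dM uM.
have : 'D_v (fun y => invmx (M y) *m M y) x = 0.
  rewrite -(derive_cst (1%:M : 'M[R]_n) x v); apply: near_eq_derive.
  by apply: filterS uM => y uy; rewrite mulVmx.
rewrite derive_mulmx// => /(congr1 (fun A => A *m invmx (M x))).
rewrite mulmxDl mul0mx mulmxK ?(nbhs_singleton uM)// => /eqP.
by rewrite addr_eq0 => /eqP ->.
Qed.

End MatrixDifferentiation.

(** * Finite orders of differentiability on an open set *)

Section ContinuouslyDifferentiable.
Context {R : realType} {m : nat}.
Variable U : set 'rV[R]_m.
Hypothesis openU : open U.

(** All partial derivatives of order at most [k] are still differentiable on [U], so level 0 is
    already differentiability and the partials of order [k] are continuous. A finite order, unlike
    [smooth_on], allows induction: the derivative of a product or an inverse is an expression in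
    maps of the preceding level. *)
Fixpoint Ck (W : normedModType R) (k : nat) (f : 'rV[R]_m -> W) : Prop :=
  (forall x, U x -> differentiable f x) /\
  (if k is k'.+1 then forall i, Ck k' ('D_(evec i) f) else True).

Lemma Ck_diff (W : normedModType R) k (f : 'rV[R]_m -> W) x :
  Ck k f -> U x -> differentiable f x.
Proof. by case: k => [|k] [df _]; exact: df. Qed.

Lemma CkS (W : normedModType R) k (f : 'rV[R]_m -> W) : Ck k.+1 f -> Ck k f.
Proof.
elim: k f => [|k IH] f [df Df]; first by split.
by split=> // i; apply: IH; exact: Df.
Qed.

Lemma Ck_derive (W : normedModType R) k (f : 'rV[R]_m -> W) i :
  Ck k.+1 f -> Ck k ('D_(evec i) f).
Proof. by move=> [_ Df]; exact: Df. Qed.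

Lemma Ck_ext (W : normedModType R) k (f g : 'rV[R]_m -> W) :
  (forall x, U x -> f x = g x) -> Ck k f -> Ck k g.
Proof.
have eqn (h l : 'rV[R]_m -> W) x : (forall x, U x -> h x = l x) -> U x ->
    \forall y \near x, h y = l y.
  by move=> hl Ux; apply: filterS (open_nbhs_nbhs (conj openU Ux)).
elim: k f g => [|k IH] f g fg [df Df]; split=> //.
- by move=> x Ux; apply: near_eq_differentiable (eqn _ _ _ fg Ux) (df x Ux).
- by move=> x Ux; apply: near_eq_differentiable (eqn _ _ _ fg Ux) (df x Ux).
- move=> i; apply: IH (Df i) => x Ux.
  exact: near_eq_derive (eqn _ _ _ fg Ux).
Qed.

Lemma smooth_on_Ck (W : normedModType R) k (f : 'rV[R]_m -> W) :
  smooth_on U f -> Ck k f.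
Proof.
elim: k f => [|k IH] f sf; split=> //.
- exact: (sf [::]).
- exact: (sf [::]).
- move=> i; apply: IH => s x Ux.
  (* [foldr] applies the last direction of the list first, so the derivative already taken goes to
     the end. *)
  by have := sf (rcons s i) x Ux; rewrite foldr_rcons.
Qed.

Lemma Ck_cst (W : normedModType R) k (w : W) : Ck k (cst w).
Proof.
elim: k w => [|k IH] w; split=> //; try by move=> x _; exact: differentiable_cst.
move=> i; apply: Ck_ext (IH 0) => x _.
by rewrite derive_cst.
Qed.

Lemma CkD (W : normedModType R) k (f g : 'rV[R]_m -> W) :
  Ck k f -> Ck k g -> Ck k (fun y => f y + g y).
Proof.
elim: k f g => [|k IH] f g Cf Cg; split=> //;
  try by move=> x Ux; apply: differentiableD; apply: Ck_diff Ux; eassumption.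
move=> i; apply: Ck_ext (IH _ _ (Ck_derive i Cf) (Ck_derive i Cg)) => x Ux.
by rewrite deriveD//; apply: diff_derivable; apply: Ck_diff Ux; eassumption.
Qed.

Lemma CkZ (W : normedModType R) k (c : R) (f : 'rV[R]_m -> W) :
  Ck k f -> Ck k (fun y => c *: f y).
Proof.
elim: k f => [|k IH] f Cf; split=> //;
  try by move=> x Ux; apply: differentiableZ; apply: Ck_diff Ux; eassumption.
move=> i; apply: Ck_ext (IH _ (Ck_derive i Cf)) => x Ux.
by rewrite deriveZ//; apply: diff_derivable; apply: Ck_diff Ux; eassumption.
Qed.

Lemma CkN (W : normedModType R) k (f : 'rV[R]_m -> W) :
  Ck k f -> Ck k (fun y => - f y).
Proof. by move/(CkZ (-1)); apply: Ck_ext => x _; rewrite scaleN1r. Qed.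

Lemma Ck_entry p q k (M : 'rV[R]_m -> 'M[R]_(p, q)) a b :
  Ck k M -> Ck k (fun y => M y a b).
Proof.
elim: k M => [|k IH] M CM; split=> //;
  try by move=> x Ux; apply: differentiable_entry; apply: Ck_diff Ux; eassumption.
move=> i; apply: Ck_ext (IH _ (Ck_derive i CM)) => x Ux.
by rewrite derive_entry//; apply: Ck_diff Ux; eassumption.
Qed.

Lemma Ck_mx p q k (M : 'rV[R]_m -> 'M[R]_(p, q)) :
  (forall a b, Ck k (fun y => M y a b)) -> Ck k M.
Proof.
have dM l (N : 'rV[R]_m -> 'M[R]_(p, q)) x :
    (forall a b, Ck l (fun y => N y a b)) -> U x -> differentiable N x.
  by move=> CN Ux; apply: differentiable_mx => a b; apply: Ck_diff Ux; exact: CN.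
elim: k M => [|k IH] M CM; split=> //; try by move=> x; exact: dM.
move=> i; apply: IH => a b; apply: Ck_ext (Ck_derive i (CM a b)) => x Ux.
by rewrite derive_entry//; exact: dM Ux.
Qed.

Lemma Ck_mulmx p q r k (M : 'rV[R]_m -> 'M[R]_(p, q))
    (N : 'rV[R]_m -> 'M[R]_(q, r)) :
  Ck k M -> Ck k N -> Ck k (fun y => M y *m N y).
Proof.
elim: k M N => [|k IH] M N CM CN; split=> //; try by move=> x Ux;
  apply: differentiable_mulmx; apply: Ck_diff Ux; eassumption.
move=> i; apply: Ck_ext (CkD (IH _ _ (Ck_derive i CM) (CkS CN))
  (IH _ _ (CkS CM) (Ck_derive i CN))) => x Ux.
by rewrite derive_mulmx//; apply: Ck_diff Ux; eassumption.
Qed.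

Lemma Ck_trmx p q k (M : 'rV[R]_m -> 'M[R]_(p, q)) :
  Ck k M -> Ck k (fun y => (M y)^T).
Proof.
move=> CM; apply: Ck_mx => a b.
by apply: Ck_ext (Ck_entry b a CM) => x _; rewrite mxE.
Qed.

(** Bootstrap: the derivative [- M^-1 (dM) M^-1] contains the inverse itself only at the level
    already reached. *)
Lemma Ck_invmx n k (M : 'rV[R]_m -> 'M[R]_n) :
  (forall y, U y -> M y \in unitmx) -> Ck k M -> Ck k (fun y => invmx (M y)).
Proof.
move=> uM.
have uMn x : U x -> \forall y \near x, M y \in unitmx.
  by move=> Ux; apply: filterS (open_nbhs_nbhs (conj openU Ux)).
elim: k => [|k IH] CM; split=> //; try by move=> x Ux;
  apply: differentiable_invmx; [apply: Ck_diff Ux; eassumption|exact: uMn].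
move=> i; have CI := IH (CkS CM).
apply: Ck_ext (CkN (Ck_mulmx (Ck_mulmx CI (Ck_derive i CM)) CI)) => x Ux.
by rewrite derive_invmx//; [apply: Ck_diff Ux; eassumption|exact: uMn].
Qed.

Lemma Ck_sum (I : Type) (s : seq I) (W : normedModType R) k
    (f : I -> 'rV[R]_m -> W) :
  (forall i, Ck k (f i)) -> Ck k (fun y => \sum_(i <- s) f i y).
Proof.
move=> Cf; elim: s => [|i s IH].
  by under eq_fun do rewrite big_nil; exact: Ck_cst.
under eq_fun do rewrite big_cons.
exact: CkD.
Qed.

Lemma CkM k (c : 'rV[R]_m -> R) (f : 'rV[R]_m -> R) :
  Ck k c -> Ck k f -> Ck k (fun y => c y * f y).
Proof.
elim: k c f => [|k IH] c f Cc Cf; split=> //; try by move=> x Ux;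
  apply: differentiableM; apply: Ck_diff Ux; eassumption.
move=> i; apply: Ck_ext (CkD (IH _ _ (CkS Cc) (Ck_derive i Cf))
  (IH _ _ (CkS Cf) (Ck_derive i Cc))) => x Ux.
by rewrite deriveM//; apply: diff_derivable; apply: Ck_diff Ux; eassumption.
Qed.

End ContinuouslyDifferentiable.

(** * Chain rule in coordinates *)

Section ChainRule.
Context {R : realType} {m n : nat}.

Lemma derive_comp (W : normedModType R) (f : 'rV[R]_m -> 'rV[R]_n)
    (h : 'rV[R]_n -> W) x v :
  differentiable f x -> differentiable h (f x) ->
  'D_v (fun y => h (f y)) x =
  \sum_(i < n) ('D_v f x) 0 i *: 'D_(evec i) h (f x).
Proof.
move=> df dh; rewrite deriveE; last exact: differentiable_comp.
rewrite diff_comp//= -[X in 'd h _ X]deriveE// [X in 'd h _ X]row_sum_delta.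
rewrite linear_sum /=.
by apply: eq_bigr => i _; rewrite linearZ /= (deriveE _ dh).
Qed.

Variables (U : set 'rV[R]_m) (V : set 'rV[R]_n).
Hypotheses (openU : open U).

Lemma Ck_comp p q k (f : 'rV[R]_m -> 'rV[R]_n) (h : 'rV[R]_n -> 'M[R]_(p, q)) :
  (forall x, U x -> V (f x)) -> Ck U k f -> Ck V k h ->
  Ck U k (fun y => h (f y)).
Proof.
move=> fUV; elim: k h => [|k IH] h Cf Ch; split=> //; try by move=> x Ux;
  apply: differentiable_comp; [apply: Ck_diff Ux; eassumption
                              |apply: Ck_diff (fUV _ Ux); eassumption].
move=> i.
apply: (@Ck_ext _ _ _ openU _ _
  (fun y => \sum_(j < n) ('D_(evec i) f y) 0 j *: 'D_(evec j) h (f y))).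
  move=> x Ux; rewrite derive_comp//; first by apply: Ck_diff Ux; eassumption.
  by apply: Ck_diff (fUV _ Ux); eassumption.
apply: Ck_sum => // j; apply: Ck_mx => // a b.
under eq_fun do rewrite mxE.
apply: CkM => //; first exact: (Ck_entry openU 0 j (Ck_derive i Cf)).
apply: (@Ck_entry _ _ _ openU _ _ _ (fun y => 'D_(evec j) h (f y)) a b).
exact: (IH ('D_(evec j) h) (CkS Cf) (Ck_derive j Ch)).
Qed.

End ChainRule.

(** * Symmetry of mixed partial derivatives *)

Section MixedPartials.
Context {R : realType} {V : normedModType R}.
Implicit Types (f : V -> R) (x y u v : V).

Lemma is_derive_line f y u (s : R) : derivable f (s *: u + y) u ->
  is_derive s 1 (fun t => f (t *: u + y)) ('D_u f (s *: u + y)).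
Proof.
have e : (fun h : R => h^-1 *: (((fun t => f (t *: u + y)) \o shift s)
      (h *: 1) - f (s *: u + y))) =
    (fun h => h^-1 *: ((f \o shift (s *: u + y)) (h *: u) - f (s *: u + y))).
  apply/funext => h /=; congr (_ *: (f _ - _)).
  by rewrite [h%:A]mulr1 scalerDl addrA.
by move=> df; split; rewrite /derivable /derive e.
Qed.

Lemma MVT_line f y u (h : R) : 0 < h ->
  (forall s : R, 0 <= s <= h -> derivable f (s *: u + y) u) ->
  exists2 s : R, 0 <= s <= h &
    f (h *: u + y) - f y = h * 'D_u f (s *: u + y).
Proof.
move=> h0 df.
have [||s] := @MVT R (fun t => f (t *: u + y)) (fun s => 'D_u f (s *: u + y)) 0 h h0.
- move=> s; rewrite in_itv /= => /andP[s0 sh].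
  by apply: is_derive_line; apply: df; rewrite !ltW.
- apply: derivable_within_continuous => s; rewrite in_itv /= => sh.
  by have [] := is_derive_line (df s sh).
rewrite in_itv /= scale0r add0r subr0 mulrC => /andP[s0 sh] e.
by exists s => //; rewrite !ltW.
Qed.

(** Two mean value theorems: along [u] for the increment [k y = f (h v + y) - f y], then along [v]
    for ['D_u f]. *)
Lemma second_difference f x u v (h : R) : 0 < h ->
  (forall s t : R, 0 <= s <= h -> 0 <= t <= h ->
    derivable f (s *: u + (t *: v + x)) u /\
    derivable ('D_u f) (s *: u + (t *: v + x)) v) ->
  exists s t : R, [/\ 0 <= s <= h, 0 <= t <= h &
    f (h *: u + (h *: v + x)) - f (h *: u + x) - f (h *: v + x) + f x =
    h ^+ 2 * 'D_v ('D_u f) (s *: u + (t *: v + x))].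
Proof.
move=> h0 df.
have h0h : 0 <= h <= h by rewrite (ltW h0) lexx.
have h00 : (0 : R) <= 0 <= h by rewrite (ltW h0) lexx.
pose k y := f (h *: v + y) - f y.
have shiftD y s : 0 <= s <= h -> y = s *: u + x ->
    is_derive y u k ('D_u f (h *: v + y) - 'D_u f y).
  move=> sh ->; apply: is_deriveB; last first.
    by have := (df s 0 sh h00).1; rewrite scale0r add0r => /derivableP.
  have [d _] := df s h sh h0h; rewrite addrCA in d.
  have e : (fun l : R => l^-1 *: (((fun y => f (h *: v + y)) \o
        shift (s *: u + x)) (l *: u) - f (h *: v + (s *: u + x)))) =
      (fun l => l^-1 *: ((f \o shift (h *: v + (s *: u + x))) (l *: u) -
        f (h *: v + (s *: u + x)))).
    by apply/funext => l /=; rewrite addrCA.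
  by split; rewrite /derivable /derive e.
have [s sh e1] : exists2 s : R, 0 <= s <= h &
    k (h *: u + x) - k x = h * 'D_u k (s *: u + x).
  apply: (@MVT_line k x u h h0) => s sh.
  by have [] := shiftD _ s sh erefl.
have [t th e2] : exists2 t : R, 0 <= t <= h &
    'D_u f (h *: v + (s *: u + x)) - 'D_u f (s *: u + x) =
    h * 'D_v ('D_u f) (t *: v + (s *: u + x)).
  apply: (@MVT_line ('D_u f) (s *: u + x) v h h0) => t th.
  by have [_] := df s t sh th; rewrite addrCA.
exists s, t; split; [exact: sh|exact: th|].
have [_ e3] := shiftD _ s sh erefl.
rewrite expr2 -mulrA [s *: u + _]addrCA -e2 -e3 -e1 /k [h *: v + (h *: u + x)]addrCA.
by rewrite opprB -[LHS]addrA [- _ + f x]addrC.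
Qed.

(** Schwarz's theorem. The second difference is symmetric in [u] and [v], so each mixed derivative
    takes, at some point near [x], the same value as the other one at another point near [x];
    continuity concludes. *)
Lemma derive_comm f x u v :
  (\forall y \near x, derivable f y u /\ derivable ('D_u f) y v) ->
  (\forall y \near x, derivable f y v /\ derivable ('D_v f) y u) ->
  {for x, continuous ('D_v ('D_u f))} -> {for x, continuous ('D_u ('D_v f))} ->
  'D_v ('D_u f) x = 'D_u ('D_v f) x.
Proof.
move=> duv dvu cuv cvu; apply/eqP; rewrite -subr_eq0 -normr_le0.
apply/ler_addgt0Pr => e e0; rewrite add0r.
have e20 : 0 < e / 2 by rewrite divr_gt0.
have nuv : \forall y \near x, `|'D_v ('D_u f) x - 'D_v ('D_u f) y| < e / 2.
  exact: (@cvgrPdist_lt _ _ _ _ _ _ _).1 cuv _ e20.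
have nvu : \forall y \near x, `|'D_u ('D_v f) x - 'D_u ('D_v f) y| < e / 2.
  exact: (@cvgrPdist_lt _ _ _ _ _ _ _).1 cvu _ e20.
have /nbhs_ballP[d /= d0 B] : \forall y \near x,
    ((derivable f y u /\ derivable ('D_u f) y v) /\
     (derivable f y v /\ derivable ('D_v f) y u)) /\
    (`|'D_v ('D_u f) x - 'D_v ('D_u f) y| < e / 2 /\
     `|'D_u ('D_v f) x - 'D_u ('D_v f) y| < e / 2).
  exact: filterI (filterI duv dvu) (filterI nuv nvu).
(* With this step every [s u + t v] has norm at most [h (|u| + |v|) < d]; the summand 1 makes the
   inequality strict and covers [u = v = 0]. *)
pose h := d / (`|u| + `|v| + 1).
have D0 : 0 < `|u| + `|v| + 1 by rewrite ltr_wpDl // addr_ge0.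
have h0 : 0 < h by rewrite divr_gt0.
have inB s t : 0 <= s <= h -> 0 <= t <= h -> ball x d (s *: u + (t *: v + x)).
  move=> /andP[s0 sh] /andP[t0 th]; rewrite -ball_normE /= addrA.
  rewrite opprD addrCA subrr addr0 normrN (le_lt_trans (ler_normD _ _))//.
  rewrite !normrZ !ger0_norm//.
  apply: (@le_lt_trans _ _ (h * (`|u| + `|v|))).
    by rewrite mulrDr lerD// ler_wpM2r.
  by rewrite /h mulrAC ltr_pdivrMr// ltr_pM2l// ltrDl.
have [|s [t [sh th e1]]] := @second_difference f x u v h h0.
  by move=> s t sh th; exact: (B _ (inB s t sh th)).1.1.
have [|s' [t' [sh' th' e2]]] := @second_difference f x v u h h0.
  by move=> s' t' sh' th'; rewrite addrCA; exact: (B _ (inB t' s' th' sh')).1.2.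
have E : 'D_v ('D_u f) (s *: u + (t *: v + x)) =
    'D_u ('D_v f) (t' *: u + (s' *: v + x)).
  apply: (@mulfI _ (h ^+ 2)); first by rewrite expf_neq0// gt_eqF.
  rewrite -e1 [t' *: u + _]addrCA -e2 [h *: v + (h *: u + _)]addrCA.
  by congr (_ + _); rewrite addrAC.
have n1 := (B _ (inB s t sh th)).2.1.
have n2 := (B _ (inB t' s' th' sh')).2.2.
rewrite -(subrKA ('D_v ('D_u f) (s *: u + (t *: v + x)))).
apply: (le_trans (ler_normD _ _)); rewrite (splitr e); apply: lerD; first exact: ltW n1.
rewrite E distrC; exact: ltW n2.
Qed.

End MixedPartials.

(** Taken entrywise, since the mean value theorem behind [derive_comm] needs real values. Level 2
    makes the second partials continuous. *)
Lemma Ck_derive_comm (R : realType) m p q (U : set 'rV[R]_m)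
    (M : 'rV[R]_m -> 'M[R]_(p, q)) i j x : open U -> Ck U 2 M -> U x ->
  'D_(evec i) ('D_(evec j) M) x = 'D_(evec j) ('D_(evec i) M) x.
Proof.
move=> openU CM Ux; apply/matrixP => a b.
have nU : \forall y \near x, U y by exact: open_nbhs_nbhs.
have Ce (k l : 'I_m) := Ck_derive l (Ck_derive k (Ck_entry openU a b CM)).
have E k l : ('D_(evec l) ('D_(evec k) M) x) a b =
    'D_(evec l) ('D_(evec k) (fun y => M y a b)) x.
  rewrite -derive_entry; last by apply: (Ck_diff (Ck_derive k CM)).
  apply: near_eq_derive; apply: filterS nU => y Uy.
  by rewrite derive_entry//; apply: (Ck_diff CM).
have D k l : \forall y \near x, derivable (fun y => M y a b) y (evec k) /\
    derivable ('D_(evec k) (fun y => M y a b)) y (evec l).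
  apply: filterS nU => y Uy; split; apply: diff_derivable.
    exact: (Ck_diff (Ck_entry openU a b CM)).
  exact: (Ck_diff (Ck_derive k (Ck_entry openU a b CM))).
rewrite [LHS]E [RHS]E.
apply: (derive_comm (D j i) (D i j)); apply: differentiable_continuous.
  exact: (Ck_diff (Ce j i)).
exact: (Ck_diff (Ce i j)).
Qed.

(** * Connections in coordinates *)

(* Otherwise unification unfolds limits when it compares two derivatives. *)
#[local] Opaque derive.

Section Christoffel.
Context {R : realType} {n : nat}.
Variables (V : set 'rV[R]_n) (G : 'rV[R]_n -> 'M[R]_n).
Hypotheses (openV : open V) (CG : forall k, Ck V k G).
Hypotheses (symG : forall z, V z -> (G z)^T = G z).
Hypotheses (unitG : forall z, V z -> G z \in unitmx).

(* The j-th row is nabla_i e_j. *)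
Definition christoffel_mx (z : 'rV[R]_n) (i : 'I_n) : 'M[R]_n :=
  \matrix_(j, k) christoffel G z k i j.

Lemma derive_metric_sym z i : V z ->
  ('D_(evec i) G z)^T = 'D_(evec i) G z.
Proof.
move=> Vz; rewrite -derive_trmx; last exact: (Ck_diff (CG 0)).
by apply: near_eq_derive; apply: filterS (open_nbhs_nbhs (conj openV Vz)).
Qed.

(** Koszul formula: lowering the upper index cancels the inverse metric. As [G z] is invertible,
    this identity characterises the Christoffel symbols, and they are later identified through it
    without computing an inverse. *)
Lemma christoffel_mx_metric z i : V z ->
  christoffel_mx z i *m G z = \matrix_(j, l) (2^-1 *
    (('D_(evec i) G z) j l + ('D_(evec j) G z) i l - ('D_(evec l) G z) i j)).
Proof.
move=> Vz; apply/matrixP => j l; rewrite !mxE.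
have symI : (invmx (G z))^T = invmx (G z) by rewrite trmx_inv symG.
pose w := \row_l (2^-1 * (('D_(evec i) G z) j l + ('D_(evec j) G z) i l -
  ('D_(evec l) G z) i j)).
transitivity ((w *m invmx (G z) *m G z) 0 l); last first.
  by rewrite mulmxKV ?unitG// mxE.
rewrite mxE; apply: eq_bigr => k _; congr (_ * _).
rewrite !mxE /christoffel mulr_sumr; apply: eq_bigr => a _.
by rewrite -[in LHS]symI !mxE mulrA mulrAC.
Qed.

Lemma christoffel_mx_sym z i j k : V z ->
  christoffel_mx z i j k = christoffel_mx z j i k.
Proof.
move=> Vz; rewrite !mxE /christoffel; congr (_ * _); apply: eq_bigr => l _.
congr (_ * _); congr (_ - _); first exact: addrC.
by rewrite -[in LHS](derive_metric_sym l Vz) mxE.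
Qed.

(** Metric compatibility: in the Koszul formula plus its transpose only the derivative in the
    direction [i] survives. *)
Lemma derive_metric z i : V z ->
  'D_(evec i) G z = christoffel_mx z i *m G z + (christoffel_mx z i *m G z)^T.
Proof.
move=> Vz; rewrite christoffel_mx_metric//; apply/matrixP => j l; rewrite !mxE.
rewrite -mulrDr.
have s a b c : ('D_(evec a) G z) b c = ('D_(evec a) G z) c b.
  by rewrite -[in LHS](derive_metric_sym a Vz) mxE.
move: (s i l j).
generalize ('D_(evec i) G z) ('D_(evec j) G z) ('D_(evec l) G z) => A B C ->.
by field.
Qed.

Lemma Ck_christoffel_mx k i : Ck V k (christoffel_mx^~ i).
Proof.
pose L z := \matrix_(j, l) (2^-1 *
  (('D_(evec i) G z) j l + ('D_(evec j) G z) i l - ('D_(evec l) G z) i j)).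
apply: (@Ck_ext _ _ _ openV _ _ (fun z => L z *m invmx (G z))).
  by move=> z Vz; rewrite /L -christoffel_mx_metric// mulmxK// unitG.
apply: Ck_mulmx => //; last exact: Ck_invmx.
apply: Ck_mx => // j l; rewrite /L; under eq_fun do rewrite mxE.
apply: CkM => //; first exact: Ck_cst.
have C a b c := Ck_entry openV b c (Ck_derive a (CG k.+1)).
by apply: CkD => //; [apply: CkD => //; exact: C|apply: CkN => //; exact: C].
Qed.

(* The j-th row is R(e_l, e_m) e_j. *)
Definition riemann_mx (z : 'rV[R]_n) (l m : 'I_n) : 'M[R]_n :=
  ('D_(evec l) (christoffel_mx^~ m) z : 'M[R]_n) - 'D_(evec m) (christoffel_mx^~ l) z
  + christoffel_mx z m *m christoffel_mx z l
  - christoffel_mx z l *m christoffel_mx z m.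

End Christoffel.

(** * Connection pulled back along a map *)

Section ConnectionAlongMap.
Context {R : realType} {m n : nat}.
Variables (V : set 'rV[R]_n) (G : 'rV[R]_n -> 'M[R]_n).
Hypotheses (openV : open V) (CG : forall k, Ck V k G).
Hypotheses (symG : forall z, V z -> (G z)^T = G z).
Hypotheses (unitG : forall z, V z -> G z \in unitmx).
Variables (U : set 'rV[R]_m) (f : 'rV[R]_m -> 'rV[R]_n).
Hypotheses (openU : open U) (Cf : forall k, Ck U k f).
Hypothesis fUV : forall x, U x -> V (f x).

Definition connection_mx (i : 'I_m) (x : 'rV[R]_m) : 'M[R]_n :=
  \sum_(l < n) ('D_(evec i) f x) 0 l *: christoffel_mx G (f x) l.

Definition covder p (i : 'I_m) (W : 'rV[R]_m -> 'M[R]_(p, n)) x :=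
  ('D_(evec i) W x : 'M[R]_(p, n)) + W x *m connection_mx i x.

Lemma covdE i (W : 'rV[R]_m -> 'rV[R]_n) x :
  covd G f W (evec i) x = covder i W x.
Proof.
rewrite /covd /covder; congr (_ + _); apply/rowP => k; rewrite !mxE.
rewrite exchange_big /=; apply: eq_bigr => j _.
rewrite /connection_mx summxE mulr_sumr; apply: eq_bigr => l _.
by rewrite !mxE mulrC [christoffel _ _ _ _ _ * _]mulrC.
Qed.

Lemma jacobian_entry x i l : U x -> ('J f x) i l = ('D_(evec i) f x) 0 l.
Proof.
move=> Ux; rewrite deriveEjacobian; last exact: (Ck_diff (Cf 0)).
by rewrite /evec -rowE [RHS]mxE.
Qed.

Lemma Ck_jacobian k : Ck U k (fun x => 'J f x).
Proof.
apply: Ck_mx => // i l.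
apply: (@Ck_ext _ _ _ openU _ _ (fun x => ('D_(evec i) f x) 0 l)).
  by move=> x Ux; rewrite jacobian_entry.
exact: (Ck_entry openU 0 l (Ck_derive i (Cf k.+1))).
Qed.

Lemma Ck_connection_mx k i : Ck U k (connection_mx i).
Proof.
apply: Ck_sum => // l; apply: Ck_mx => // a b; under eq_fun do rewrite mxE.
apply: CkM => //; first exact: (Ck_entry openU 0 l (Ck_derive i (Cf k.+1))).
apply: (@Ck_entry _ _ _ openU _ _ _ (fun y => christoffel_mx G (f y) l)).
exact: (Ck_comp openU fUV (Cf k) (Ck_christoffel_mx openV CG symG unitG k l)).
Qed.

Lemma Ck_covder p k i (W : 'rV[R]_m -> 'M[R]_(p, n)) :
  Ck U k.+1 W -> Ck U k (covder i W).
Proof.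
move=> CW; apply: CkD => //; first exact: Ck_derive.
by apply: Ck_mulmx => //; [exact: CkS|exact: Ck_connection_mx].
Qed.

(** Metric compatibility survives the pull-back: by the chain rule both sides are the same
    combination of the identities [derive_metric]. *)
Lemma derive_metric_along x i : U x ->
  'D_(evec i) (fun y => G (f y)) x =
  connection_mx i x *m G (f x) + (connection_mx i x *m G (f x))^T.
Proof.
move=> Ux; rewrite derive_comp; [|exact: (Ck_diff (Cf 0))|
  by apply: (Ck_diff (CG 0)); exact: fUV].
rewrite /connection_mx mulmx_suml linear_sum -big_split /=; apply: eq_bigr => l _.
by rewrite (derive_metric openV CG symG unitG)//; [rewrite -scalemxAl linearZ scalerDr|exact: fUV].
Qed.

Lemma derive_gram p q (W : 'rV[R]_m -> 'M[R]_(p, n))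
    (Z : 'rV[R]_m -> 'M[R]_(q, n)) x i : U x ->
  differentiable W x -> differentiable Z x ->
  'D_(evec i) (fun y => W y *m G (f y) *m (Z y)^T) x =
  covder i W x *m G (f x) *m (Z x)^T + W x *m G (f x) *m (covder i Z x)^T.
Proof.
move=> Ux dW dZ.
have dG : differentiable (fun y => G (f y)) x.
  exact: (Ck_diff (Ck_comp openU fUV (Cf 0) (CG 0))).
rewrite derive_mulmx; [|exact: differentiable_mulmx|exact: differentiable_trmx].
rewrite derive_mulmx// derive_trmx// derive_metric_along//.
have tD (A B : 'M[R]_(q, n)) : (A + B)^T = A^T + B^T by rewrite linearD.
have Vfx := fUV Ux.
rewrite /covder tD !trmx_mul symG// !(mulmxDl, mulmxDr) !mulmxA.
rewrite -!addrA; congr (_ + (_ + _)).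
by rewrite addrC.
Qed.

(** The pulled-back connection has no torsion: second partials of [f] commute and the Christoffel
    symbols are symmetric in their lower indices. *)
Lemma covder_jacobian_sym x i j : U x ->
  row j (covder i (fun y => 'J f y) x) = row i (covder j (fun y => 'J f y) x).
Proof.
move=> Ux.
have nU : \forall y \near x, U y by exact: open_nbhs_nbhs.
have E a b : row b (covder a (fun y => 'J f y) x) =
    ('D_(evec a) ('D_(evec b) f) x : 'rV[R]_n) +
    'D_(evec b) f x *m connection_mx a x.
  apply/rowP => k; rewrite [LHS]mxE [LHS]mxE [RHS]mxE; congr (_ + _).
    rewrite -derive_entry; last exact: (Ck_diff (Ck_jacobian 0)).
    rewrite -derive_entry; last exact: (Ck_diff (Ck_derive b (Cf 1))).
    apply: near_eq_derive; apply: filterS nU => y Uy.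
    exact: jacobian_entry.
  by rewrite !mxE; apply: eq_bigr => l _; rewrite jacobian_entry.
have e1 := Ck_derive_comm i j openU (Cf 2) Ux.
have e2 : 'D_(evec j) f x *m connection_mx i x =
    'D_(evec i) f x *m connection_mx j x.
  apply/rowP => k.
  have S a b : ('D_(evec a) f x *m connection_mx b x) 0 k =
      \sum_(s < n) \sum_(l < n) ('D_(evec a) f x) 0 s *
        (('D_(evec b) f x) 0 l * christoffel_mx G (f x) l s k).
    rewrite mxE; apply: eq_bigr => s _.
    by rewrite summxE mulr_sumr; apply: eq_bigr => l _; rewrite mxE.
  apply: (etrans (S j i)); apply: esym; apply: (etrans (S i j)).
  rewrite [LHS]exchange_big /=.
  apply: eq_bigr => a _.
  apply: eq_bigr => b _.
  rewrite (christoffel_mx_sym openV CG symG a b k (fUV Ux)).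
  exact: mulrCA.
apply: (etrans (E i j)); apply: esym; apply: (etrans (E j i)); apply: esym.
exact: (congr2 (fun a b : 'rV[R]_n => a + b) e1 e2).
Qed.

(** Matrices act on the right, so [∇_i ∇_j] produces the product
    [connection_mx j *m connection_mx i]; this fixes the signs of the quadratic terms. *)
Definition connection_curvature i j x : 'M[R]_n :=
  ('D_(evec i) (connection_mx j) x : 'M[R]_n) - 'D_(evec j) (connection_mx i) x
  + connection_mx j x *m connection_mx i x
  - connection_mx i x *m connection_mx j x.

(** In the expansion [E] the second partials commute and the two first-order terms are exchanged
    when [i] and [j] are, so only terms of order zero in [W] remain. *)
Lemma covder_comm p (W : 'rV[R]_m -> 'M[R]_(p, n)) x i j : U x -> Ck U 2 W ->
  covder i (covder j W) x - covder j (covder i W) x =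
  W x *m connection_curvature i j x.
Proof.
move=> Ux CW.
have dW : differentiable W x := Ck_diff CW Ux.
have dC a : differentiable (connection_mx a) x.
  exact: (Ck_diff (Ck_connection_mx 0 a)).
have dWa a : differentiable ('D_(evec a) W) x := Ck_diff (Ck_derive a CW) Ux.
have E a b : covder a (covder b W) x = 'D_(evec a) ('D_(evec b) W) x +
    ('D_(evec a) W x *m connection_mx b x + 'D_(evec b) W x *m connection_mx a x)
    + W x *m ('D_(evec a) (connection_mx b) x +
      connection_mx b x *m connection_mx a x).
  rewrite {1}/covder deriveD; last 2 first.
  - exact/diff_derivable.
  - by apply/diff_derivable; exact: differentiable_mulmx.
  rewrite derive_mulmx// /covder mulmxDl mulmxDr !mulmxA -!addrA.
  by congr (_ + (_ + _)); rewrite addrCA.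
rewrite (E i j) (E j i).
move: (Ck_derive_comm i j openU CW Ux).
generalize ('D_(evec i) ('D_(evec j) W) x) => B ->.
rewrite [X in _ + X + _ - _]addrC.
rewrite opprD addrACA subrr add0r -mulmxBr; congr (_ *m _).
by rewrite /connection_curvature opprD addrACA addrA.
Qed.

(** The curvature of the pulled-back connection is the pull-back of the Riemann tensor: the extra
    terms carry second partials of [f], which are symmetric and cancel. *)
Lemma connection_curvatureE x i j : U x -> connection_curvature i j x =
  \sum_(l < n) \sum_(k < n) (('D_(evec i) f x) 0 l * ('D_(evec j) f x) 0 k) *:
    riemann_mx G (f x) l k.
Proof.
move=> Ux; have Vfx := fUV Ux.
pose F a l := ('D_(evec a) f x) 0 l.
have dchr l : differentiable (fun y => christoffel_mx G (f y) l) x.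
  exact: (Ck_diff (Ck_comp openU fUV (Cf 0)
    (Ck_christoffel_mx openV CG symG unitG 0 l))).
have dF a l : differentiable (fun y => ('D_(evec a) f y) 0 l) x.
  exact: (Ck_diff (Ck_entry openU 0 l (Ck_derive a (Cf 1)))).
have D a b : 'D_(evec a) (connection_mx b) x =
    \sum_(k < n) ('D_(evec a) ('D_(evec b) f) x) 0 k *: christoffel_mx G (f x) k
    + \sum_(l < n) \sum_(k < n) (F a l * F b k) *:
        'D_(evec l) ((christoffel_mx G)^~ k) (f x).
  have -> : connection_mx b = \sum_(l < n)
      (fun y => ('D_(evec b) f y) 0 l *: christoffel_mx G (f y) l).
    by apply/funext => y; rewrite fct_sumE.
  have dt l : differentiable (fun y => ('D_(evec b) f y) 0 l *:
      christoffel_mx G (f y) l) x by exact: differentiable_scalemx.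
  rewrite derive_sum => [|l]; last exact/diff_derivable.
  rewrite [X in _ + X]exchange_big -big_split /=; apply: eq_bigr => k _.
  rewrite derive_scalemx// derive_entry; last exact: (Ck_diff (Ck_derive b (Cf 1))).
  rewrite (derive_comp (h := (christoffel_mx G)^~ k)); [|exact: (Ck_diff (Cf 0))|
    exact: (Ck_diff (Ck_christoffel_mx openV CG symG unitG 0 k))].
  congr (_ + _); rewrite scaler_sumr; apply: eq_bigr => l _.
  by rewrite scalerA mulrC.
pose S (H : 'I_n -> 'I_n -> 'M[R]_n) :=
  \sum_(l < n) \sum_(k < n) (F i l * F j k) *: H l k.
have M a b : connection_mx b x *m connection_mx a x = \sum_(l < n) \sum_(k < n)
    (F a l * F b k) *: (christoffel_mx G (f x) k *m christoffel_mx G (f x) l).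
  rewrite /connection_mx mulmx_suml exchange_big; apply: eq_bigr => k _ /=.
  rewrite mulmx_sumr; apply: eq_bigr => l _.
  by rewrite -scalemxAl -scalemxAr scalerA mulrC.
have SC (H : 'I_n -> 'I_n -> 'M[R]_n) :
    \sum_(l < n) \sum_(k < n) (F j l * F i k) *: H l k = S (fun l k => H k l).
  by rewrite exchange_big; apply: eq_bigr => l _; apply: eq_bigr => k _;
    rewrite mulrC.
transitivity (S (fun l k => 'D_(evec l) ((christoffel_mx G)^~ k) (f x)) -
    S (fun l k => 'D_(evec k) ((christoffel_mx G)^~ l) (f x)) +
    S (fun l k => christoffel_mx G (f x) k *m christoffel_mx G (f x) l) -
    S (fun l k => christoffel_mx G (f x) l *m christoffel_mx G (f x) k)).
  have M2 := etrans (M j i)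
    (SC (fun l k => christoffel_mx G (f x) k *m christoffel_mx G (f x) l)).
  have D2 := etrans (D j i) (congr1 (+%R _)
    (SC (fun l k => 'D_(evec l) ((christoffel_mx G)^~ k) (f x)))).
  have E (A B C K A' B' C' K' : 'M[R]_n) : A = A' -> B = B' -> C = C' ->
      K = K' -> A - B + C - K = A' - B' + C' - K' by move=> -> -> -> ->.
  apply: (etrans (E _ _ _ _ _ _ _ _ (D i j) D2 (M i j) M2)).
  move: (Ck_derive_comm i j openU (Cf 2) Ux).
  generalize ('D_(evec i) ('D_(evec j) f) x) => B ->.
  by rewrite opprD addrACA subrr add0r.
rewrite /S -sumrB -big_split -sumrB; apply: eq_bigr => l _ /=.
rewrite -sumrB -big_split -sumrB; apply: eq_bigr => k _ /=.
by rewrite /riemann_mx !(scalerDr, scalerN).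
Qed.

End ConnectionAlongMap.

(** * Curvature of the model metric *)

(* Polynomials in x, y and the conformal factor lambda.  They are closed under
   differentiation, since d lambda = - kappa / 2 * lambda ^ 2 * (x dx + y dy), and
   all Christoffel symbols of the model metric are of this form. *)
Inductive cexpr (R : Type) :=
  CX | CY | CL | CC of R | CA of cexpr R & cexpr R | CM of cexpr R & cexpr R.
Arguments CX {R}.
Arguments CY {R}.
Arguments CL {R}.
Arguments CC {R} _%_ring_scope.

Section ModelMetric.
Context {R : realType}.
Variables (kappa tau : R).

Let x (z : 'rV[R]_3) := z 0 0.
Let y (z : 'rV[R]_3) := z 0 1.
Let lam (z : 'rV[R]_3) := (conformal_denom kappa z)^-1.

Fixpoint ceval (e : cexpr R) (a b c : R) : R :=
  match e with
  | CX => a | CY => b | CL => c | CC k => k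
  | CA e1 e2 => ceval e1 a b c + ceval e2 a b c
  | CM e1 e2 => ceval e1 a b c * ceval e2 a b c
  end.

Fixpoint cderive (e : cexpr R) (a b c da db dc : R) : R :=
  match e with
  | CX => da | CY => db | CL => dc | CC k => 0
  | CA e1 e2 => cderive e1 a b c da db dc + cderive e2 a b c da db dc
  | CM e1 e2 => ceval e1 a b c * cderive e2 a b c da db dc
                + cderive e1 a b c da db dc * ceval e2 a b c
  end.

Lemma is_derive_coord (z v : 'rV[R]_3) (i : 'I_3) :
  is_derive z v (fun w => w 0 i) (v 0 i).
Proof.
split; first exact/diff_derivable/differentiable_coord.
by rewrite (derive_entry (M := id)) ?derive_id// ; exact: differentiable_id.
Qed.

Lemma is_derive_lam z v : conformal_denom kappa z != 0 ->
  is_derive z v lam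
    (- (kappa / 2 * (x z * v 0 0 + y z * v 0 1)) * lam z * lam z).
Proof.
move=> d0.
have dx := is_derive_coord z v 0.
have dy := is_derive_coord z v 1.
have dd : is_derive z v (conformal_denom kappa)
    (kappa / 2 * (x z * v 0 0 + y z * v 0 1)).
  have -> : conformal_denom kappa = cst 1 + kappa / 4 *: (x * x + y * y).
    by apply/funext => w; rewrite /conformal_denom !expr2.
  have dxy := is_deriveD (is_deriveM dx dx) (is_deriveM dy dy).
  apply: (is_derive_eq (is_deriveD (is_derive_cst (1 : R) z v)
    (is_deriveZ (kappa / 4) dxy))).
  by rewrite /GRing.scale /= -/(x z) -/(y z); field.
have [ed _] := dd; split; first exact: derivableV d0 ed.
rewrite (deriveV d0 ed).
have [_ ->] := dd; rewrite /lam -[LHS]/(_ * _) -exprVn; ring.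
Qed.

(** A single induction yields the derivative of every coefficient that occurs, so that later
    derivatives are obtained by evaluating [cderive]. *)
Lemma is_derive_ceval e z v : conformal_denom kappa z != 0 ->
  is_derive z v (fun w => ceval e (x w) (y w) (lam w))
    (cderive e (x z) (y z) (lam z) (v 0 0) (v 0 1)
      (- (kappa / 2 * (x z * v 0 0 + y z * v 0 1)) * lam z * lam z)).
Proof.
move=> d0; elim: e => [||| k|e1 IH1 e2 IH2|e1 IH1 e2 IH2] /=.
- exact: is_derive_coord.
- exact: is_derive_coord.
- exact: is_derive_lam.
- exact: is_derive_cst.
- exact: is_deriveD.
- apply: (is_derive_eq (is_deriveM IH1 IH2)).
  by rewrite /GRing.scale /=; congr (_ + _); rewrite mulrC.
Qed.

Definition CN (e : cexpr R) := CM (CC (-1)) e.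

(* The coordinates of omega = dz + tau lambda (y dx - x dy), the form dual to
   xi. *)
Definition omega_expr (i : nat) : cexpr R :=
  match i with
  | 0 => CM (CC tau) (CM CL CY)
  | 1 => CM (CC (- tau)) (CM CL CX)
  | _ => CC 1
  end%N.

Definition model_expr (i j : nat) : cexpr R :=
  let w := CM (omega_expr i) (omega_expr j) in
  if (i == j)%N && (i < 2)%N then CA (CM CL CL) w else w.

(* christoffel_expr i j k is Gamma^k_ij. *)
Definition christoffel_expr (i j k : nat) : cexpr R :=
  match i, j, k with
  | 0, 0, 0 => CM (CC (- (kappa / 2))) (CM CX CL)
  | 0, 0, 1 => CM (CC (kappa / 2 - 2 * tau ^+ 2)) (CM CY CL)
  | 0, 0, _ => CM (CC (tau * (kappa / 2 - 2 * tau ^+ 2))) (CM (CM CX CY) (CM CL CL))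
  | 1, 1, 0 => CM (CC (kappa / 2 - 2 * tau ^+ 2)) (CM CX CL)
  | 1, 1, 1 => CM (CC (- (kappa / 2))) (CM CY CL)
  | 1, 1, _ => CM (CC (- (tau * (kappa / 2 - 2 * tau ^+ 2)))) (CM (CM CX CY) (CM CL CL))
  | 0, 1, 0 | 1, 0, 0 => CM (CC (tau ^+ 2 - kappa / 2)) (CM CY CL)
  | 0, 1, 1 | 1, 0, 1 => CM (CC (tau ^+ 2 - kappa / 2)) (CM CX CL)
  | 0, 1, _ | 1, 0, _ =>
      CM (CC (tau * (kappa / 4 - tau ^+ 2)))
        (CM (CM CL CL) (CA (CM CY CY) (CN (CM CX CX))))
  | 0, _, 1 | _, 0, 1 => CC (- tau)
  | 0, 2, 2 | 2, 0, 2 => CM (CC (- tau ^+ 2)) (CM CX CL)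
  | 1, _, 0 | _, 1, 0 => CC tau
  | 1, 2, 2 | 2, 1, 2 => CM (CC (- tau ^+ 2)) (CM CY CL)
  | _, _, _ => CC 0
  end%N.

Let ev e (z : 'rV[R]_3) := ceval e (x z) (y z) (lam z).

Let dv e l (z : 'rV[R]_3) : R :=
  let a := (l == 0)%N%:R in let b := (l == 1)%N%:R in
  cderive e (x z) (y z) (lam z) a b
      (- (kappa / 2 * (x z * a + y z * b)) * lam z * lam z).

Lemma evec_entry (l j : 'I_3) : (evec l : 'rV[R]_3) 0 j = (l == j :> nat)%:R.
Proof. by rewrite mxE eqxx eq_sym. Qed.

Lemma is_derive_ev e z (l : 'I_3) : conformal_denom kappa z != 0 ->
  is_derive z (evec l) (ev e) (dv e l z).
Proof.
by move=> /(is_derive_ceval e (evec l)); rewrite !evec_entry.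
Qed.

Definition o0 : 'I_3 := @Ordinal 3 0 isT.
Definition o1 : 'I_3 := @Ordinal 3 1 isT.
Definition o2 : 'I_3 := @Ordinal 3 2 isT.

Lemma sum_ord3 (F : 'I_3 -> R) : \sum_i F i = F o0 + F o1 + F o2.
Proof.
rewrite !big_ord_recl big_ord0 addr0 addrA.
by congr (F _ + F _ + F _); apply: val_inj.
Qed.

Lemma ord3P (P : 'I_3 -> Prop) : P o0 -> P o1 -> P o2 -> forall i, P i.
Proof.
move=> P0 P1 P2 [[|[|[|//]]] Hi].
- by rewrite (_ : Ordinal Hi = o0) //; apply: val_inj.
- by rewrite (_ : Ordinal Hi = o1) //; apply: val_inj.
- by rewrite (_ : Ordinal Hi = o2) //; apply: val_inj.
Qed.

Lemma model_metricE z i j : model_metric kappa tau z i j = ev (model_expr i j) z.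
Proof.
rewrite /model_metric; cbv zeta.
rewrite !mxE big_ord_recl big_ord0 addr0 !mxE !eqxx.
rewrite /ev /model_expr -/(x z) -/(y z) -/(lam z).
move: i j; apply: ord3P; apply: ord3P; rewrite /= /omega_expr /=; ring.
Qed.

Variables (V : set 'rV[R]_3) (G : 'rV[R]_3 -> 'M[R]_3).
Hypotheses (openV : open V) (CG : forall k, Ck V k G).
Hypotheses (symG : forall z, V z -> (G z)^T = G z).
Hypotheses (unitG : forall z, V z -> G z \in unitmx).
Hypotheses (modelG : forall z, V z -> G z = model_metric kappa tau z).
Hypotheses (denomV : forall z, V z -> conformal_denom kappa z != 0).

Lemma derive_model (z : 'rV[R]_3) (l i j : 'I_3) : V z ->
  ('D_(evec l) G z) i j = dv (model_expr i j) l z.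
Proof.
move=> Vz; rewrite -derive_entry; last exact: (Ck_diff (CG 0)).
have [_ <-] := is_derive_ev (model_expr i j) l (denomV Vz).
apply: near_eq_derive; apply: filterS (open_nbhs_nbhs (conj openV Vz)) => w Vw.
by rewrite modelG// model_metricE.
Qed.

(** The first part has the form of the side condition that [field] leaves after clearing the
    quotient κ / 4. *)
Lemma lamE (z : 'rV[R]_3) : V z -> 4 + kappa * (x z ^+ 2 + y z ^+ 2) != 0 /\
  lam z = (1 + kappa / 4 * (x z ^+ 2 + y z ^+ 2))^-1.
Proof.
move=> Vz; split=> //; have := denomV Vz.
have -> : 4 + kappa * (x z ^+ 2 + y z ^+ 2) = 4 * conformal_denom kappa z.
  by rewrite /conformal_denom -/(x z) -/(y z); field.
by rewrite mulf_eq0 pnatr_eq0.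
Qed.

(** The listed symbols are verified rather than derived: after multiplication by the invertible
    metric, the claim is the Koszul formula, that is 27 rational identities. *)
Lemma christoffel_modelE (z : 'rV[R]_3) (i j k : 'I_3) : V z ->
  christoffel_mx G z i j k = ev (christoffel_expr i j k) z.
Proof.
move=> Vz; pose M := \matrix_(j, k) ev (christoffel_expr i j k) z : 'M[R]_3.
suff -> : christoffel_mx G z i = M by rewrite mxE.
rewrite -[LHS](mulmxK (unitG Vz)) -[RHS](mulmxK (unitG Vz)); congr (_ *m _).
rewrite (christoffel_mx_metric symG unitG)//.
apply/matrixP => {}j l; rewrite [LHS]mxE [RHS]mxE sum_ord3.
rewrite (modelG Vz) !model_metricE !mxE.
move: (derive_model i j l Vz) (derive_model j i l Vz) (derive_model l i j Vz).
generalize (('D_(evec i) G z) j l) (('D_(evec j) G z) i l)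
  (('D_(evec l) G z) i j) => A B C -> -> ->; rewrite /ev /dv.
have [d0 hL] := lamE Vz.
move: (x z) (y z) (lam z) d0 hL => a b c d0 hL.
clear M; move: i j l; apply: ord3P; apply: ord3P; apply: ord3P;
  rewrite /= hL; field; exact: d0.
Qed.

Lemma derive_christoffel_model (z : 'rV[R]_3) (l m p q : 'I_3) : V z ->
  ('D_(evec l) (christoffel_mx G ^~ m) z) p q = dv (christoffel_expr m p q) l z.
Proof.
move=> Vz; rewrite -derive_entry; last first.
  exact: (Ck_diff (Ck_christoffel_mx openV CG symG unitG 0 m)).
have [_ <-] := is_derive_ev (christoffel_expr m p q) l (denomV Vz).
apply: near_eq_derive; apply: filterS (open_nbhs_nbhs (conj openV Vz)) => w Vw.
exact: christoffel_modelE.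
Qed.

Definition omega_form (z : 'rV[R]_3) : 'rV[R]_3 := \row_i ev (omega_expr i) z.

(** [omega_form] is the form dual to ξ and [ord_max == q] is the [q]-th component of ξ. The first
    line is the tensor of a space of constant curvature κ - 3τ²; the rest lowers the curvature of
    vertical planes to τ². *)
Lemma riemann_modelE (z : 'rV[R]_3) (l m p q : 'I_3) : V z ->
  riemann_mx G z l m p q =
  (kappa - 3 * tau ^+ 2) * (G z p m * (l == q)%:R - G z p l * (m == q)%:R) +
  (kappa - 4 * tau ^+ 2) *
    (omega_form z 0 l * omega_form z 0 p * (m == q)%:R
     + G z p l * omega_form z 0 m * (ord_max == q)%:R
     - omega_form z 0 m * omega_form z 0 p * (l == q)%:R
     - G z p m * omega_form z 0 l * (ord_max == q)%:R).
Proof.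
move=> Vz; rewrite (modelG Vz) !model_metricE /omega_form.
rewrite !(mxE _ _ 0).
have mulE a b : (christoffel_mx G z a *m christoffel_mx G z b) p q =
    ev (christoffel_expr a p o0) z * ev (christoffel_expr b o0 q) z +
    ev (christoffel_expr a p o1) z * ev (christoffel_expr b o1 q) z +
    ev (christoffel_expr a p o2) z * ev (christoffel_expr b o2 q) z.
  by rewrite mxE sum_ord3 !(christoffel_modelE _ _ _ Vz).
have entryE (A B C D : 'M[R]_3) (a b c d : R) : A p q = a -> B p q = b ->
    C p q = c -> D p q = d -> (A - B + C - D) p q = a - b + c - d.
  by move=> <- <- <- <-; rewrite !mxE.
apply: (etrans (entryE _ _ _ _ _ _ _ _ (derive_christoffel_model l m p q Vz)
  (derive_christoffel_model m l p q Vz) (mulE m l) (mulE l m))) => {mulE entryE}.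
have [d0 hL] := lamE Vz; rewrite /ev /dv.
move: (x z) (y z) (lam z) d0 hL => a b c d0 hL.
move: l m p q; do 4 apply: ord3P; rewrite /= ?hL; field; by rewrite ?d0.
Qed.

End ModelMetric.

(** * Curvature of the model applied to a normal vector *)

Section ModelCurvatureAlongMap.
Context {R : realType} {m : nat}.
Variables (kappa tau : R) (V : set 'rV[R]_3) (G : 'rV[R]_3 -> 'M[R]_3).
Hypotheses (openV : open V) (CG : forall k, Ck V k G).
Hypotheses (symG : forall z, V z -> (G z)^T = G z).
Hypotheses (unitG : forall z, V z -> G z \in unitmx).
Hypotheses (modelG : forall z, V z -> G z = model_metric kappa tau z).
Hypotheses (denomV : forall z, V z -> conformal_denom kappa z != 0).
Variables (U : set 'rV[R]_m) (f : 'rV[R]_m -> 'rV[R]_3).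
Hypotheses (openU : open U) (Cf : forall k, Ck U k f).
Hypothesis fUV : forall x, U x -> V (f x).

Lemma model_vertical z u : V z ->
  inner (G z) u (vertical z) = (u *m (omega_form kappa tau z)^T) 0 0.
Proof.
move=> Vz; rewrite /inner -mulmxA; congr ((_ *m _) 0 0).
apply/colP => i; rewrite /vertical /evec trmx_delta -colE !mxE.
rewrite modelG// model_metricE.
by move: i; apply: ord3P; rewrite /= ?mulr1.
Qed.

Lemma riemann_model_contract z (u v : 'rV[R]_3) : V z ->
  \sum_(l < 3) \sum_(k < 3) (u 0 l * v 0 k) *: riemann_mx G z l k =
  (kappa - 3 * tau ^+ 2) *: (G z *m v^T *m u - G z *m u^T *m v) +
  (kappa - 4 * tau ^+ 2) *:
    (inner (G z) u (vertical z) *: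
       ((omega_form kappa tau z)^T *m v - G z *m v^T *m vertical z) -
     inner (G z) v (vertical z) *:
       ((omega_form kappa tau z)^T *m u - G z *m u^T *m vertical z)).
Proof.
move=> Vz; rewrite !model_vertical//; apply/matrixP => p q.
rewrite summxE.
under eq_bigr => l _.
  rewrite summxE.
  under eq_bigr => k _ do rewrite mxE (riemann_modelE openV CG symG unitG modelG denomV)//.
  over.
move: (omega_form kappa tau z) (G z) => w g.
rewrite !sum_ord3 /vertical /evec !(mxE, sum_ord3, big_ord1).
move: q; apply: ord3P; rewrite /=; ring.
Qed.

(** Each summand in which the metric pairs the argument with [u] or [v] vanishes on [nu]. This
    removes the whole constant-curvature part and leaves the two terms with [omega_form] twice. *)
Lemma riemann_model_normal z (nu u v : 'rV[R]_3) : V z ->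
  inner (G z) nu u = 0 -> inner (G z) nu v = 0 ->
  nu *m \sum_(l < 3) \sum_(k < 3) (u 0 l * v 0 k) *: riemann_mx G z l k =
  ((kappa - 4 * tau ^+ 2) * inner (G z) nu (vertical z)) *:
    (inner (G z) u (vertical z) *: v - inner (G z) v (vertical z) *: u).
Proof.
move=> Vz nuu nuv.
have nuG w : inner (G z) nu w = 0 -> nu *m G z *m w^T = 0.
  by move=> nuw; apply/matrixP => a b; rewrite !ord1 [RHS]mxE; exact: nuw.
rewrite riemann_model_contract// mulmxDr -!scalemxAr !mulmxBr -!scalemxAr.
rewrite !mulmxBr !mulmxA !nuG// !mul0mx.
rewrite subrr scaler0 add0r !subr0 [inner _ nu _]model_vertical//.
rewrite [nu *m _]mx11_scalar !mul_scalar_mx -scalerA; congr (_ *: _).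
by rewrite scalerBr !scalerA -mx11_scalar [inner _ u _ * _]mulrC [inner _ v _ * _]mulrC.
Qed.

Lemma model_curvature_normal x (nu : 'rV[R]_3) i j : U x ->
  (forall l, inner (G (f x)) nu ('D_(evec l) f x) = 0) ->
  nu *m connection_curvature G f i j x =
  ((kappa - 4 * tau ^+ 2) * inner (G (f x)) nu (vertical (f x))) *:
    (inner (G (f x)) ('D_(evec i) f x) (vertical (f x)) *: 'D_(evec j) f x -
     inner (G (f x)) ('D_(evec j) f x) (vertical (f x)) *: 'D_(evec i) f x).
Proof.
move=> Ux nu0.
rewrite (connection_curvatureE openV CG symG unitG openU Cf fUV _ _ Ux).
exact: (riemann_model_normal (fUV Ux) (nu0 i) (nu0 j)).
Qed.

End ModelCurvatureAlongMap.

(** * Gauss and Codazzi equations *)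

(** The four hypotheses say that a square block matrix has a right inverse, which is then also a
    left inverse. *)
Lemma col_mul_row_mx_eq1 (R : comNzRingType) m n (A : 'M[R]_(m, m + n))
    (B : 'M[R]_(n, m + n)) (C : 'M[R]_(m + n, m)) (D : 'M[R]_(m + n, n)) :
  A *m C = 1%:M -> A *m D = 0 -> B *m C = 0 -> B *m D = 1%:M ->
  C *m A + D *m B = 1%:M.
Proof.
move=> AC AD BC BD; rewrite -mul_row_col; apply: mulmx1C.
by rewrite mul_col_row AC AD BC BD -scalar_mx_block.
Qed.

Section Surface.
Context {R : realType}.
Variables (V : set 'rV[R]_3) (G : 'rV[R]_3 -> 'M[R]_3).
Hypotheses (openV : open V) (CG : forall k, Ck V k G).
Hypotheses (symG : forall z, V z -> (G z)^T = G z).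
Hypotheses (unitG : forall z, V z -> G z \in unitmx).
Variables (U : set 'rV[R]_2) (f nu : 'rV[R]_2 -> 'rV[R]_3).
Variable g : 'rV[R]_2 -> 'M[R]_2.
Hypotheses (openU : open U) (Cf : forall k, Ck U k f).
Hypotheses (Cnu : forall k, Ck U k nu) (Cg : forall k, Ck U k g).
Hypothesis fUV : forall x, U x -> V (f x).
Hypothesis immersed : forall x, U x -> row_free ('J f x).
Hypothesis unitg : forall x, U x -> g x \in unitmx.
Hypothesis induced : forall x, U x ->
  g x = 'J f x *m G (f x) *m ('J f x)^T.
Hypothesis normal : forall x, U x -> 'J f x *m G (f x) *m (nu x)^T = 0.
Hypothesis unit_nu : forall x, U x -> nu x *m G (f x) *m (nu x)^T = 1%:M.

Lemma induced_sym x : U x -> (g x)^T = g x.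
Proof.
move=> Ux; rewrite induced// !trmx_mul trmxK symG ?mulmxA//; exact: fUV.
Qed.

(* v |-> v *m tangent_proj x is the tangential component of v, in the basis
   of coordinate vectors. *)
Definition tangent_proj x : 'M[R]_(3, 2) :=
  G (f x) *m ('J f x)^T *m invmx (g x).

Lemma jacobian_proj x : U x -> 'J f x *m tangent_proj x = 1%:M.
Proof.
by move=> Ux; rewrite /tangent_proj !mulmxA -induced// mulmxV// unitg.
Qed.

Lemma normal_proj x : U x -> nu x *m tangent_proj x = 0.
Proof.
move=> Ux; rewrite /tangent_proj !mulmxA.
have -> : nu x *m G (f x) *m ('J f x)^T = ('J f x *m G (f x) *m (nu x)^T)^T.
  by rewrite !trmx_mul trmxK symG ?mulmxA//; exact: fUV.
by rewrite normal// trmx0 mul0mx.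
Qed.

Lemma tangent_normal_decomposition x : U x ->
  tangent_proj x *m 'J f x + G (f x) *m (nu x)^T *m nu x = 1%:M.
Proof.
move=> Ux; apply: (@col_mul_row_mx_eq1 _ 2 1 ('J f x)).
  exact: jacobian_proj.
- by rewrite mulmxA normal.
- exact: normal_proj.
- by rewrite mulmxA unit_nu.
Qed.

Lemma covmx_row y i : row i (covmx G f nu y) = covder G f i nu y.
Proof. by rewrite -covdE; apply/rowP => k; rewrite mxE mxE. Qed.

(** Differentiating [<nu, nu> = 1] gives twice the pairing of [nu] with its derivative. *)
Lemma normal_derivative_tangent x : U x ->
  covmx G f nu x *m G (f x) *m (nu x)^T = 0.
Proof.
move=> Ux; apply/row_matrixP => i; rewrite !row_mul covmx_row row0.
set c := covder G f i nu x.
have dnu : differentiable nu x := Ck_diff (Cnu 0) Ux.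
have E : c *m G (f x) *m (nu x)^T + nu x *m G (f x) *m c^T = 0.
  rewrite -(derive_gram openV CG symG unitG openU Cf fUV i Ux dnu dnu).
  rewrite -(derive_cst (1%:M : 'M[R]_1) x (evec i)); apply: near_eq_derive.
  by apply: filterS (open_nbhs_nbhs (conj openU Ux)).
have T : nu x *m G (f x) *m c^T = c *m G (f x) *m (nu x)^T.
  have -> : nu x *m G (f x) *m c^T = (c *m G (f x) *m (nu x)^T)^T.
    by rewrite !trmx_mul trmxK symG ?mulmxA//; exact: fUV.
  by apply/matrixP => a b; rewrite !ord1 mxE.
move: E; rewrite T -mulr2n -scaler_nat => /eqP; rewrite scaler_eq0 pnatr_eq0 /=.
by move/eqP.
Qed.

Lemma covmx_tangent x : U x ->
  covmx G f nu x = covmx G f nu x *m tangent_proj x *m 'J f x.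
Proof.
move=> Ux; have z : covmx G f nu x *m (G (f x) *m (nu x)^T *m nu x) = 0.
  by rewrite !mulmxA normal_derivative_tangent// mul0mx.
rewrite -[LHS]mulmx1 -(tangent_normal_decomposition Ux) mulmxDr z addr0.
exact: mulmxA.
Qed.

Local Notation A := (shape_operator G f nu).

(** The derivative of [nu] is tangent, and on tangent vectors [pinvmx] and [tangent_proj] agree. The
    right-hand side is built from smooth data, which gives the smoothness of the shape operator. *)
Lemma shape_operatorE x : U x -> A x = - covmx G f nu x *m tangent_proj x.
Proof.
move=> Ux; rewrite /shape_operator !mulNmx; congr (- _).
rewrite [in LHS]covmx_tangent// -[LHS]mulmxA mulmxVp ?immersed//.
exact: mulmx1.
Qed.

Lemma weingarten x : U x -> A x *m 'J f x = - covmx G f nu x.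
Proof.
by move=> Ux; rewrite shape_operatorE// !mulNmx -covmx_tangent.
Qed.

Lemma Ck_covmx k : Ck U k (covmx G f nu).
Proof.
apply: Ck_mx => // i j.
apply: (@Ck_ext _ _ _ openU _ _ (fun y => covder G f i nu y 0 j)).
  by move=> y Uy; rewrite -covmx_row mxE.
apply: (@Ck_entry _ _ _ openU _ _ _ (covder G f i nu)).
exact: (Ck_covder openV CG symG unitG openU Cf fUV i (Cnu k.+1)).
Qed.

Lemma Ck_shape_operator k : Ck U k A.
Proof.
apply: (@Ck_ext _ _ _ openU _ _ (fun y => - (covmx G f nu y *m tangent_proj y))).
  by move=> x Ux; rewrite shape_operatorE// mulNmx.
apply: CkN => //; apply: Ck_mulmx => //; first exact: Ck_covmx.
apply: Ck_mulmx => //; last exact: Ck_invmx.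
apply: Ck_mulmx => //; first exact: (Ck_comp openU fUV (Cf k) (CG k)).
apply: Ck_trmx => //; exact: Ck_jacobian.
Qed.

Lemma derive_induced x i : U x -> 'D_(evec i) g x =
  covder G f i (fun y => 'J f y) x *m G (f x) *m ('J f x)^T +
  (covder G f i (fun y => 'J f y) x *m G (f x) *m ('J f x)^T)^T.
Proof.
move=> Ux; have dJ := Ck_diff (Ck_jacobian openU Cf 0) Ux.
rewrite [X in _ + X]trmx_mul trmxK [X in _ + _ *m X]trmx_mul symG; last exact: fUV.
rewrite mulmxA -(derive_gram openV CG symG unitG openU Cf fUV i Ux dJ dJ).
apply: near_eq_derive.
by apply: filterS (open_nbhs_nbhs (conj openU Ux)).
Qed.

(* The Levi-Civita connection of the induced metric is the tangential part of
   the ambient one. *)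
Lemma gauss_formula x i : U x ->
  covder G f i (fun y => 'J f y) x *m tangent_proj x = christoffel_mx g x i.
Proof.
move=> Ux; rewrite /tangent_proj !mulmxA.
(* [c a j l] is [<∇_a ∂_j f, ∂_l f>]. Its symmetry in [a] and [j], together with
   [∂_a g_pq = c a p q + c a q p], determines it by the Koszul argument. *)
pose c a := covder G f a (fun y => 'J f y) x *m G (f x) *m ('J f x)^T.
have c_sym a b l : c a b l = c b a l.
  have e := covder_jacobian_sym openV CG symG openU Cf fUV a b Ux.
  have r h k : row k (c h) =
      row k (covder G f h (fun y => 'J f y) x) *m G (f x) *m ('J f x)^T.
    by rewrite /c !row_mul.
  have : row b (c a) = row a (c b).
    apply: (etrans (r a b)); apply: esym; apply: (etrans (r b a)).
    exact: (congr1 (fun w => w *m G (f x) *m ('J f x)^T) (esym e)).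
  have rE (M : 'M[R]_2) h : (row h M) 0 l = M h l by rewrite mxE.
  by move=> /(congr1 (fun w : 'rV[R]_2 => w 0 l)); move: (c a) (c b) => M N; rewrite !rE.
rewrite -[RHS](mulmxK (unitg Ux)); congr (_ *m _).
rewrite (christoffel_mx_metric induced_sym unitg)//.
apply/matrixP => j l; rewrite [RHS]mxE.
have D a p q : ('D_(evec a) g x) p q = c a p q + c a q p.
  by rewrite derive_induced// [LHS]mxE [X in _ + X]mxE.
rewrite -/(c i).
move: (D i j l) (D j i l) (D l i j).
generalize (('D_(evec i) g x) j l) (('D_(evec j) g x) i l)
  (('D_(evec l) g x) i j) => a b d -> -> -> {D}.
clearbody c.
rewrite (c_sym j i l) (c_sym l i j) (c_sym l j i).
by field.
Qed.

(** The [j]-th row is [∇_i (A e_j)]. The term [A (∇_i e_j)] that would complete the covariant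
    derivative of [A] is left out: it is symmetric in [i] and [j] and drops out of the Codazzi
    difference. *)
Definition covariant_shape i x : 'M[R]_2 :=
  ('D_(evec i) A x : 'M[R]_2) + A x *m christoffel_mx g x i.

(** Differentiate the Weingarten equation [A J = - ∇nu] along [f] and project: by the Gauss formula
    the left side becomes [covariant_shape]. *)
Lemma covariant_shapeE x i j : U x -> row i (covariant_shape j x) =
  - (covder G f j (covder G f i nu) x *m tangent_proj x).
Proof.
move=> Ux.
have dJ := Ck_diff (Ck_jacobian openU Cf 0) Ux.
have dA := Ck_diff (Ck_shape_operator 0) Ux.
have dB := Ck_diff (Ck_covmx 0) Ux.
have L : covder G f j (fun y => A y *m 'J f y) x =
    'D_(evec j) A x *m 'J f x + A x *m covder G f j (fun y => 'J f y) x.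
  by rewrite /covder derive_mulmx// mulmxDr addrA !mulmxA.
have N : covder G f j (fun y => A y *m 'J f y) x = - covder G f j (covmx G f nu) x.
  have d : 'D_(evec j) (fun y => A y *m 'J f y) x =
      - 'D_(evec j) (covmx G f nu) x.
    rewrite -deriveN; last exact: diff_derivable.
    apply: near_eq_derive; apply: filterS (open_nbhs_nbhs (conj openU Ux)).
    exact: weingarten.
  apply: (etrans (congr2 (fun a b : 'M[R]_(2, 3) =>
    a + b *m connection_mx G f j x) d (weingarten Ux))).
  by rewrite mulNmx -opprD.
have rowN : row i (covder G f j (covmx G f nu) x) =
    covder G f j (covder G f i nu) x.
  rewrite /covder linearD /= row_mul covmx_row; congr (_ + _).
  apply/rowP => k; rewrite [LHS]mxE.
  apply: (etrans (esym (derive_entry (evec j) i k dB))).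
  have -> : (fun y => covmx G f nu y i k) = (fun y => covder G f i nu y 0 k).
    by apply/funext => y; rewrite -covmx_row [RHS]mxE.
  apply: derive_entry.
  exact: (Ck_diff (Ck_covder openV CG symG unitG openU Cf fUV i (Cnu 1)) Ux).
have -> : covariant_shape j x =
    covder G f j (fun y => A y *m 'J f y) x *m tangent_proj x.
  rewrite L mulmxDl -(mulmxA ('D_(evec j) A x)) (jacobian_proj Ux) mulmx1.
  by rewrite -(mulmxA (A x)) (gauss_formula _ Ux).
by rewrite row_mul N linearN /= rowN mulNmx.
Qed.

(** By [covariant_shapeE] the left side is the tangential part of a commutator of covariant
    derivatives of [nu]. *)
Lemma codazzi x i j : U x ->
  row i (covariant_shape j x) - row j (covariant_shape i x) =
  - (nu x *m connection_curvature G f j i x *m tangent_proj x).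
Proof.
move=> Ux; rewrite !covariant_shapeE//.
rewrite -(covder_comm openV CG symG unitG openU Cf fUV j i Ux (Cnu 2)).
by rewrite mulmxBl opprB opprK addrC.
Qed.

(** Lowering the index of T removes [pinvmx], and the normal component of [xi] disappears because
    [nu] is orthogonal to the Jacobian rows. *)
Lemma tangent_part_metric (xi : 'rV[R]_3 -> 'rV[R]_3) x : U x ->
  g x *m (tangent_part G xi f nu x)^T = 'J f x *m G (f x) *m (xi (f x))^T.
Proof.
move=> Ux; have symGfx := symG (fUV Ux).
rewrite /tangent_part; set w := xi (f x) - _.
have wnu : w *m G (f x) *m (nu x)^T = 0.
  rewrite /w !mulmxBl -!scalemxAl unit_nu// [X in X - _]mx11_scalar.
  rewrite /angle_function /inner scalemx1; apply/eqP; rewrite subr_eq0; apply/eqP.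
  have trE (M : 'M[R]_1) : M 0 0 = M^T 0 0 by rewrite mxE.
  by congr (_%:M); rewrite trE !trmx_mul trmxK symGfx mulmxA.
have wE : w = w *m tangent_proj x *m 'J f x.
  have z : w *m (G (f x) *m (nu x)^T *m nu x) = 0 by rewrite !mulmxA wnu mul0mx.
  rewrite -[LHS]mulmx1 -(tangent_normal_decomposition Ux) mulmxDr z addr0.
  exact: mulmxA.
rewrite [in LHS]wE -[X in _ *m X^T]mulmxA mulmxVp ?immersed// mulmx1.
rewrite -[in LHS](induced_sym Ux) -trmx_mul /tangent_proj !mulmxA.
rewrite mulmxKV ?unitg// !trmx_mul trmxK symGfx mulmxA.
rewrite /w raddfB /= mulmxBr linearZ /= -scalemxAr normal// scaler0 subr0.
by [].
Qed.

End Surface.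

(** * Divergence of the Newton transformation *)

Section Divergence.
Context {R : realType} {n : nat}.
Variable g : 'rV[R]_n -> 'M[R]_n.

Lemma connection_mx_id i x : connection_mx g id i x = christoffel_mx g x i.
Proof.
rewrite /connection_mx (_ : 'D_(evec i) id x = evec i); last exact: derive_id.
rewrite (bigD1 i)//= big1 => [|l li]; last first.
  by rewrite mxE eqxx (negbTE li) scale0r.
by rewrite mxE !eqxx scale1r addr0.
Qed.

Lemma covmx_near_eq (W Z : 'rV[R]_n -> 'rV[R]_n) x :
  (\forall y \near x, W y = Z y) -> covmx g id W x = covmx g id Z x.
Proof.
move=> WZ; apply/row_matrixP => i; rewrite !rowK /covd (nbhs_singleton WZ).
by congr (_ + _); exact: near_eq_derive.
Qed.

(** The bracket is the covariant derivative of the endomorphism [P] in the direction [i], acting on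
    the right; its [(j, i)] entry summed over [i] is the [j]-th component of the one-form dual to
    div P. *)
Lemma divergence_mulmx (X : 'rV[R]_n -> 'rV[R]_n) (P : 'rV[R]_n -> 'M[R]_n) x :
  differentiable X x -> differentiable P x ->
  divergence g (fun y => X y *m P y) x = \tr (covmx g id X x *m P x) +
  \sum_(j < n) X x 0 j * \sum_(i < n)
    (('D_(evec i) P x : 'M[R]_n) + P x *m christoffel_mx g x i
     - christoffel_mx g x i *m P x) j i.
Proof.
move=> dX dP; pose c i := christoffel_mx g x i.
under [X in _ + X]eq_bigr do rewrite mulr_sumr.
rewrite exchange_big /= /divergence /mxtrace -big_split /=; apply: eq_bigr => i _.
have rowE (W : 'rV[R]_n -> 'rV[R]_n) : row i (covmx g id W x) =
    ('D_(evec i) W x : 'rV[R]_n) + W x *m c i.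
  by rewrite rowK covdE /covder connection_mx_id.
have entryE (M : 'M[R]_n) k : M i k = row i M 0 k by rewrite mxE.
rewrite [LHS]entryE rowE derive_mulmx//.
rewrite [X in _ = X + _]entryE row_mul rowE.
have -> : \sum_(j < n) X x 0 j * (('D_(evec i) P x : 'M[R]_n) + P x *m c i -
    c i *m P x) j i =
    (X x *m (('D_(evec i) P x : 'M[R]_n) + P x *m c i - c i *m P x)) 0 i.
  by rewrite [RHS]mxE.
move: (c i) (P x) (X x).
generalize ('D_(evec i) P x) ('D_(evec i) X x) => dPx dXx ci Px Xx.
have addE (u v : 'rV[R]_n) : u 0 i + v 0 i = (u + v) 0 i by rewrite [RHS]mxE.
rewrite addE; apply: (congr1 (fun M : 'rV[R]_n => M 0 i)).
rewrite mulmxDl mulmxBr mulmxDr !mulmxA.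
by rewrite -[RHS]addrA [X in _ = _ + X]addrC subrK addrA.
Qed.

End Divergence.

(** Here [D i] stands for the derivative of [A] and [L i] for the Christoffel matrix. The scalar [a]
    commutes with [L i] and cancels; symmetry of [L] turns the sum of the entries [(L i *m A) j i]
    into the trace of [L j *m A]. *)
Lemma newton_divergence_trace (R : comNzRingType) n (D L : 'I_n -> 'M[R]_n)
    (A : 'M[R]_n) (a : R) j :
  (forall i j k, L i j k = L j i k) ->
  \sum_(i < n) ((\tr (D i))%:M - D i + (a%:M - A) *m L i
    - L i *m (a%:M - A)) j i =
  \sum_(i < n) (row i (D j + A *m L j) - row j (D i + A *m L i)) 0 i.
Proof.
move=> symL.
have E i : ((\tr (D i))%:M - D i + (a%:M - A) *m L i - L i *m (a%:M - A)) j i =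
    \tr (D i) *+ (j == i) + (L i *m A) j i - (D i + A *m L i) j i.
  rewrite mulmxBl mulmxBr mul_scalar_mx mul_mx_scalar !mxE; ring.
have F i : (row i (D j + A *m L j) - row j (D i + A *m L i)) 0 i =
    (D j) i i + (A *m L j) i i - (D i + A *m L i) j i.
  by rewrite !mxE.
under eq_bigr do rewrite E; under [RHS]eq_bigr do rewrite F.
rewrite !sumrB !big_split /=; congr (_ + _ - _).
  rewrite (bigD1 j)//= eqxx mulr1n big1 ?addr0// => i ij.
  by rewrite eq_sym (negbTE ij).
rewrite -[RHS]/(\tr (A *m L j)) mxtrace_mulC; apply: eq_bigr => i _.
by rewrite !mxE; apply: eq_bigr => k _; rewrite symL.
Qed.

(** The first term contributes [s j] once and the second one [s j] twice, two being the dimension of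
    the surface. *)
Lemma sum_scaled_delta_rows (R : comNzRingType) (c : R) (s : 'cV[R]_2) j :
  \sum_(i < 2) (c *: (s i 0 *: delta_mx 0 j - s j 0 *: delta_mx 0 i) : 'rV[R]_2)
    0 i = - (c * s j 0).
Proof.
transitivity (c * (\sum_(i < 2) s i 0 *+ (i == j) - \sum_(i < 2) s j 0)).
  rewrite -sumrB mulr_sumr; apply: eq_bigr => i _.
  by rewrite !mxE !eqxx mulr1 mulr_natr.
rewrite (bigD1 j)//= eqxx mulr1n big1 => [|i ij]; last by rewrite (negbTE ij).
by rewrite sumr_const card_ord; ring.
Qed.

Section SurfaceDivergence.
Context {R : realType}.
Variables (kappa tau : R) (V : set 'rV[R]_3) (G : 'rV[R]_3 -> 'M[R]_3).
Hypotheses (openV : open V) (CG : forall k, Ck V k G).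
Hypotheses (symG : forall z, V z -> (G z)^T = G z).
Hypotheses (unitG : forall z, V z -> G z \in unitmx).
Hypotheses (modelG : forall z, V z -> G z = model_metric kappa tau z).
Hypotheses (denomV : forall z, V z -> conformal_denom kappa z != 0).
Variables (U : set 'rV[R]_2) (f nu : 'rV[R]_2 -> 'rV[R]_3).
Variable g : 'rV[R]_2 -> 'M[R]_2.
Hypotheses (openU : open U) (Cf : forall k, Ck U k f).
Hypotheses (Cnu : forall k, Ck U k nu) (Cg : forall k, Ck U k g).
Hypothesis fUV : forall x, U x -> V (f x).
Hypothesis immersed : forall x, U x -> row_free ('J f x).
Hypothesis unitg : forall x, U x -> g x \in unitmx.
Hypothesis induced : forall x, U x ->
  g x = 'J f x *m G (f x) *m ('J f x)^T.
Hypothesis normal : forall x, U x -> 'J f x *m G (f x) *m (nu x)^T = 0.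
Hypothesis unit_nu : forall x, U x -> nu x *m G (f x) *m (nu x)^T = 1%:M.

Local Notation A := (shape_operator G f nu).
Local Notation H := (mean_curvature G f nu).
Local Notation P := (newton G f nu).
Local Notation C := (angle_function G vertical f nu).
Local Notation T := (tangent_part G vertical f nu).

Let CA k : Ck U k A.
Proof. by apply: Ck_shape_operator; eassumption. Qed.

Lemma codazzi_model x i j : U x ->
  row i (covariant_shape G f nu g j x) - row j (covariant_shape G f nu g i x) =
  ((kappa - 4 * tau ^+ 2) * C x) *:
    (('J f x *m G (f x) *m (vertical (f x))^T) i 0 *: evec j -
     ('J f x *m G (f x) *m (vertical (f x))^T) j 0 *: evec i).
Proof.
move=> Ux; have rowJ l : 'D_(evec l) f x = row l ('J f x).
  rewrite deriveEjacobian; first by rewrite -rowE.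
  exact: (Ck_diff (Cf 0)).
have JP : 'J f x *m tangent_proj G f g x = 1%:M.
  by apply: jacobian_proj; eassumption.
have nuD l : inner (G (f x)) (nu x) ('D_(evec l) f x) = 0.
  rewrite rowJ /inner; have trE (M : 'M[R]_1) : M 0 0 = M^T 0 0 by rewrite mxE.
  rewrite trE !trmx_mul trmxK symG ?mulmxA; last exact: fUV.
  by rewrite -!row_mul normal// row0 mxE.
have D l : 'D_(evec l) f x *m tangent_proj G f g x = evec l.
  by rewrite rowJ -row_mul JP row1.
have t l : inner (G (f x)) ('D_(evec l) f x) (vertical (f x)) =
    ('J f x *m G (f x) *m (vertical (f x))^T) l 0.
  by rewrite rowJ /inner -!row_mul mxE.
rewrite (codazzi openV CG symG unitG openU Cf Cnu Cg fUV immersed unitg induced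
  normal unit_nu)//.
have K := model_curvature_normal openV CG symG unitG modelG denomV openU Cf fUV
  j i Ux nuD.
have alg (c a b : R) (u v : 'rV[R]_3) (u' v' : 'rV[R]_2) (Q : 'M[R]_(3, 2)) :
    u *m Q = u' -> v *m Q = v' ->
    - (c *: (a *: u - b *: v) *m Q) = c *: (b *: v' - a *: u').
  by move=> <- <-; rewrite -scalemxAl mulmxBl -!scalemxAl -scalerN opprB.
apply: (etrans (congr1 (fun M => - (M *m tangent_proj G f g x)) K)).
by rewrite (alg _ _ _ _ _ _ _ _ (D i) (D j)) !t.
Qed.

Lemma derive_newton x i : U x ->
  'D_(evec i) P x = (\tr ('D_(evec i) A x))%:M - 'D_(evec i) A x.
Proof.
move=> Ux; have dA := Ck_diff (CA 0) Ux.
have -> : P = fun y => \tr (A y) *: 1%:M - A y.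
  apply/funext => y; rewrite /newton /mean_curvature scalemx1.
  by congr (_%:M - _); rewrite mulrA mulfV ?mul1r// pnatr_eq0.
have dt := differentiable_mxtrace dA.
have d1 : differentiable (cst (1%:M : 'M[R]_2)) x by exact: differentiable_cst.
rewrite deriveB; [|exact/diff_derivable/differentiable_scalemx|exact/diff_derivable].
rewrite derive_scalemx// derive_cst scaler0 addr0 scalemx1.
by rewrite derive_mxtrace.
Qed.

(** This is div P = - (κ - 4τ²) C T with the index lowered, ready to be paired with a vector
    field. *)
Lemma divergence_newton x j : U x ->
  \sum_(i < 2) (('D_(evec i) P x : 'M[R]_2) + P x *m christoffel_mx g x i
     - christoffel_mx g x i *m P x) j i =
  - ((kappa - 4 * tau ^+ 2) * C x *
     ('J f x *m G (f x) *m (vertical (f x))^T) j 0).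
Proof.
move=> Ux.
transitivity (\sum_(i < 2) (row i (covariant_shape G f nu g j x) -
    row j (covariant_shape G f nu g i x)) 0 i); last first.
  by under eq_bigr do rewrite codazzi_model//; exact: sum_scaled_delta_rows.
have symL i k l : christoffel_mx g x i k l = christoffel_mx g x k i l.
  apply: (christoffel_mx_sym openU Cg) Ux => y Uy.
  exact: (induced_sym symG fUV induced Uy).
apply: (etrans _ (newton_divergence_trace (fun i => 'D_(evec i) A x) (A x)
  (2 * H x) j symL)).
apply: eq_bigr => i _; apply: (congr1 (fun M : 'M[R]_2 => M j i)).
by move: (derive_newton i Ux); generalize ('D_(evec i) P x) => M ->.
Qed.

Theorem divergence_newton_grad x : U x ->
  divergence g (fun y => (2 *: grad g H y) *m P y) x =
    cheng_yau g P (fun y => 2 * H y) x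
    - 2 * C x * (kappa - 4 * tau ^+ 2) * inner (g x) (grad g H x) (T x).
Proof.
move=> Ux; have nU : \forall y \near x, U y by exact: open_nbhs_nbhs.
have CH k : Ck U k H.
  apply: (@Ck_ext _ _ _ openU _ _ (fun y => 2^-1 *: (\sum_i A y i i))) => //.
  by apply: CkZ => //; apply: Ck_sum => // i; exact: Ck_entry.
have Cgrad k : Ck U k (grad g H).
  apply: Ck_mulmx => //; last exact: Ck_invmx.
  apply: Ck_mx => // a i; under eq_fun do rewrite mxE.
  exact: Ck_derive (CH k.+1).
have dX : differentiable (fun y => 2 *: grad g H y) x.
  by apply: differentiableZ; exact: (Ck_diff (Cgrad 0)).
have dP : differentiable P x.
  apply: (@Ck_diff _ _ U _ 0) Ux.
  have -> : P = fun y => (2 * H y) *: 1%:M - A y.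
    by apply/funext => y; rewrite /newton scalemx1.
  apply: CkD => //; last exact: CkN.
  apply: Ck_mx => // a b; under eq_fun do rewrite mxE.
  apply: (CkM openU); last exact: Ck_cst.
  by apply: (CkM openU); [exact: Ck_cst|exact: CH].
rewrite (divergence_mulmx g dX dP).
(* Both fields are differentiated at [x], so they must agree on a neighbourhood; [H] is known to be
   differentiable on [U], hence the restriction to [U]. *)
have -> : covmx g id (fun y => 2 *: grad g H y) x = hess g (fun y => 2 * H y) x.
  apply: covmx_near_eq; apply: filterS nU => y Uy.
  rewrite /grad scalemxAl; congr (_ *m _); apply/rowP => i; rewrite !mxE.
  by apply/esym/(@deriveZ _ _ _ H)/diff_derivable/(Ck_diff (CH 0)).
congr (_ + _).
under eq_bigr do rewrite divergence_newton//.
have symg := induced_sym symG fUV induced Ux.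
have TE := tangent_part_metric symG fUV immersed unitg induced normal unit_nu
  vertical Ux.
(* [TE] turns the metric applied to T into the covector [J G ξ] that [divergence_newton]
   produced. *)
rewrite /inner -[grad g H x *m _ *m _]mulmxA TE [in RHS]mxE mulr_sumr -sumrN; apply: eq_bigr => j _.
by rewrite mxE; ring.
Qed.

End SurfaceDivergence.

(** * From charts to the local statement *)

Lemma posdef_unitmx (R : realType) n (M : 'M[R]_n) :
  (forall v : 'rV[R]_n, v != 0 -> 0 < inner M v v) -> M \in unitmx.
Proof.
move=> posM; rewrite -row_free_unit -kermx_eq0.
apply/negP => /negP/rowV0Pn[v /sub_kermxP vM] /posM.
by rewrite /inner vM mul0mx mxE ltxx.
Qed.

(** [cinv] is continuous only within [ccod a]; openness of [ccod a] makes this enough. *)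
Lemma open_lrep_dom (R : realType) m n (M N : topologicalType)
    (a : chart R m M) (b : chart R n N) (h : M -> N) :
  continuous h -> open (lrep_dom a b h).
Proof.
move=> ch; rewrite openE => x [ax bx].
have na : \forall y \near x, ccod a y.
  by apply: open_nbhs_nbhs; split=> //; exact: ccod_open.
have nb : nbhs (cinv a x) (h @^-1` cdom b).
  by apply: ch; apply: open_nbhs_nbhs; split=> //; exact: cdom_open.
have /subspace_continuousP/(_ x ax) c := @cinv_continuous _ _ _ a.
have := c _ nb; rewrite /= nbhs_simpl /within /= => nab.
by apply: filterS (filterI na nab) => y [ay /(_ ay) ?]; split.
Qed.

Theorem lemma3p4 (R : realType) (kappa tau : R)
    (hkt : kappa <> 4 * tau ^+ 2)
    (E : homogeneous_space3 kappa tau)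
    (S : riemannian R 2) (S_connected : connected [set: S])
    (psi : S -> E) (psi_isom : isometric_immersion psi)
    (N : unit_normal psi)
    (a : chart R 2 S) (b : chart R 3 E) (a_atlas : atlas a) (b_atlas : atlas b)
    (p : S) (a_p : cdom a p) (b_p : cdom b (psi p)) :
  let g := metric a in
  let G := metric b in
  let f := lrep a b psi in
  let n := N b \o cinv a in
  let H := mean_curvature G f n in
  let P := newton G f n in
  let C := angle_function G vertical f n in
  let T := tangent_part G vertical f n in
  let x := cmap a p in
  divergence g (fun y => (2 *: grad g H y) *m P y) x =
    cheng_yau g P (fun y => 2 * H y) x
    - 2 * C x * (kappa - 4 * tau ^+ 2) * inner (g x) (grad g H x) (T x).
Proof.
move=> g G f n H P C T x.
have [[[cpsi spsi] ipsi] mpsi] := psi_isom.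
pose U := lrep_dom a b psi.
have fUV y : U y -> ccod b (f y) by move=> [_ by_]; exact: cmap_fun.
have Ux : U x.
  by split; [exact: cmap_fun|rewrite /x /= cmapK].
(* The identity is local: what remains is to read the hypotheses on the open set [U] of coordinates
   where both charts apply, from the fields of the structures involved. *)
apply: (@divergence_newton_grad R kappa tau (ccod b) G _ _ _ _ _ _ U f n g)
  => //.
- exact: ccod_open.
- by move=> k; apply: smooth_on_Ck; exact: metric_smooth.
- by move=> z; exact: (Defs.metric_sym b_atlas).
- by move=> z bz; apply: posdef_unitmx => v; exact: metric_pos.
- by move=> z; exact: (canonical_metric b_atlas).
- by move=> z bz; rewrite gt_eqF// (canonical_domain b_atlas).
- exact: open_lrep_dom.
- by move=> k; apply: smooth_on_Ck; exact: spsi.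
- by move=> k; apply: smooth_on_Ck; exact: normal_smooth.
- move=> k; apply: smooth_on_Ck => s y [ay _].
  exact: (metric_smooth a_atlas).
- by move=> y; exact: ipsi.
- by move=> y [ay _]; apply: posdef_unitmx => v; exact: metric_pos.
- by move=> y; exact: mpsi.
- move=> y [ay by_]; apply/row_matrixP => i; rewrite !row_mul row0.
  have := normal_orthogonal N (evec i) a_atlas b_atlas (cinv_fun ay) by_.
  rewrite cinvK// /inner /evec -rowE => o.
  by apply/matrixP => k l; rewrite !ord1 [RHS]mxE.
- move=> y [ay by_]; have := normal_unit N b_atlas by_; rewrite /inner => o.
  by apply/matrixP => k l; rewrite !ord1 [RHS]mxE eqxx.
Qed.
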